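(* Let $n\ge 2$, let $\Omega\subset\mathbb{R}^n$ be an open set, and let $f\in L^2_{loc}(\Omega)$. If $u\in L^2_{loc}(\Omega)$ satisfies $$\int_\Omega u\,\Delta\varphi\,dx=\int_\Omega f\varphi\,dx\qquad\text{for all }\varphi\in C_0^\infty(\Omega),$$ then $u\in W^{2,2}_{loc}(\Omega)$.
   Context: $C_0^\infty(\Omega)$ denotes the space of infinitely differentiable functions with compact support in $\Omega$. $L^2_{loc}(\Omega)$ and $W^{2,2}_{loc}(\Omega)$ are the usual local Lebesgue and Sobolev spaces; $W^{2,2}_{loc}(\Omega)$ consists of the functions in $L^2_{loc}(\Omega)$ whose distributional partial derivatives of order at most $2$ all belong to $L^2_{loc}(\Omega)$. *)

(* Defs.v *)
From HB Require Import structures.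
From mathcomp Require Import all_boot all_order all_algebra.
From mathcomp Require Import all_classical all_reals all_analysis.
From mathcomp Require Import measurable_realfun.

Set Implicit Arguments.
Unset Strict Implicit.
Unset Printing Implicit Defensive.

Import Order.TTheory GRing.Theory Num.Theory.
Import numFieldNormedType.Exports.

Local Open Scope classical_set_scope.
Local Open Scope ring_scope.

Definition borel_rV_display : measure_display.
Proof. exact: default_measure_display. Qed.

Section borel_rV.
Context {R : realType} {n : nat}.

Let borel_rV : set (set 'rV[R]_n) := <<s [set U | open U] >>.

Let borel_rV0 : borel_rV set0.
Proof. exact: sigma_algebra0. Qed.

Let borel_rVC A : borel_rV A -> borel_rV (~` A).
Proof. exact: sigma_algebraC. Qed.

Let borel_rV_bigcup (F : (set _)^nat) :
  (forall i, borel_rV (F i)) -> borel_rV (\bigcup_i F i).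
Proof. exact: sigma_algebra_bigcup. Qed.

HB.instance Definition _ := @isMeasurable.Build borel_rV_display 'rV[R]_n
  borel_rV borel_rV0 borel_rVC borel_rV_bigcup.

End borel_rV.

Section borel_rV_theory.
Context {R : realType}.

Lemma open_measurable_rV n (U : set 'rV[R]_n) : open U -> measurable U.
Proof. exact: sub_sigma_algebra. Qed.

Lemma measurable_coord n (i : 'I_n) :
  measurable_fun [set: 'rV[R]_n] (fun x : 'rV[R]_n => x ord0 i).
Proof.
apply: (measurability _ (RGenOpens.measurableE R)).
move=> _ [_ [a [b ->]] <-]; rewrite setTI; apply: open_measurable_rV.
by apply: open_comp; [move=> x _; exact: coord_continuous|exact: interval_open].
Qed.

Lemma measurable_box n (A : 'I_n -> set R) : (forall i, measurable (A i)) ->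
  measurable [set x : 'rV[R]_n | forall i, A i (x ord0 i)].
Proof.
move=> mA.
rewrite (_ : [set x | _] = \bigcap_(i in [set: 'I_n])
    ((fun x : 'rV[R]_n => x ord0 i) @^-1` A i)).
  apply: fin_bigcap_measurable => // i _.
  by rewrite -[X in measurable X]setTI; exact: measurable_coord.
by apply/seteqP; split=> x Ax i; [move=> _; exact: Ax|exact: (Ax i I)].
Qed.

Lemma measurable_fun_rVP d (T : measurableType d) n (f : T -> 'rV[R]_n) :
  measurable_fun [set: T] f <->
  forall i, measurable_fun [set: T] (fun t => f t ord0 i).
Proof.
split=> [mf i|mf].
  exact: (measurableT_comp (measurable_coord i) mf).
apply: (measurability [set U : set 'rV[R]_n | open U]) => //.
move=> _ [U oU <-]; rewrite setTI.
pose box (ab : 'rV[rat]_n * 'rV[rat]_n) := [set x : 'rV[R]_n |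
  forall i, ratr (ab.1 ord0 i) < x ord0 i < ratr (ab.2 ord0 i)].
have -> : f @^-1` U = \bigcup_ab (if `[< box ab `<=` U >] then f @^-1` box ab else set0).
  apply/seteqP; split => [t Uft|t [ab _]]; last first.
    by case: asboolP => // abU /abU.
  have [e e0 eU] : exists2 e : R, 0 < e & ball (f t) e `<=` U.
    by have /nbhs_ballP[e e0 eU] := open_nbhs_nbhs (conj oU Uft); exists e.
  have lo i : exists q : rat, f t ord0 i - e < ratr q < f t ord0 i.
    have /rat_in_itvoo[q] : f t ord0 i - e < f t ord0 i by rewrite ltrBlDr ltrDl.
    by rewrite in_itv/=; exists q.
  have up i : exists q : rat, f t ord0 i < ratr q < f t ord0 i + e.
    have /rat_in_itvoo[q] : f t ord0 i < f t ord0 i + e by rewrite ltrDl.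
    by rewrite in_itv/=; exists q.
  have [a aP] := choice lo; have [b bP] := choice up.
  exists (\row_i a i, \row_i b i) => //; case: asboolP => [_|].
    by move=> i /=; rewrite !mxE; case/andP: (aP i) (bP i) => _ -> /andP[->].
  case=> x xab; apply: eU; split=> // j i; rewrite (ord1 j).
  have /andP[+ +] := xab i; rewrite !mxE /= => ax xb.
  have /andP[a1 _] := aP i; have /andP[_ b1] := bP i.
  rewrite /ball/= ltr_distlC (lt_trans a1 ax)/=.
  exact: lt_trans xb b1.
apply: countable_bigcupT_measurable => [|ab]; first exact: countableP.
case: asboolP => // _.
rewrite (_ : _ @^-1` _ = \bigcap_(i in [set: 'I_n]) ((fun t => f t ord0 i) @^-1`
    `]ratr (ab.1 ord0 i), ratr (ab.2 ord0 i)[%classic)); last first.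
  by apply/seteqP; split=> [t + i _|t + i] => /(_ i); rewrite /= in_itv/=; auto.
apply: fin_bigcap_measurable => // i _.
by rewrite -[X in measurable X]setTI; exact: mf.
Qed.

End borel_rV_theory.

Definition cons_rV {R : realType} {n : nat} (p : R * 'rV[R]_n) : 'rV[R]_n.+1 :=
  row_mx (const_mx p.1 : 'rV[R]_1) p.2.

Section lebesgue_rV.
Context {R : realType}.

Lemma cons_rV0 n (p : R * 'rV[R]_n) : cons_rV p ord0 ord0 = p.1.
Proof.
rewrite /cons_rV; have -> : ord0 = lshift n (ord0 : 'I_1) :> 'I_(1 + n).
  exact: val_inj.
by apply: etrans (row_mxEl _ _ _ _) _; rewrite mxE.
Qed.

Lemma cons_rVS n (p : R * 'rV[R]_n) (i : 'I_n) :
  cons_rV p ord0 (lift ord0 i) = p.2 ord0 i.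
Proof.
rewrite /cons_rV; have -> : lift ord0 i = rshift 1 i :> 'I_(1 + n).
  exact: val_inj.
exact: row_mxEr.
Qed.

Lemma measurable_cons_rV n :
  measurable_fun [set: R * 'rV[R]_n] (@cons_rV R n).
Proof.
apply/measurable_fun_rVP => i; case: (unliftP ord0 i) => [j ->|->].
  under eq_fun do rewrite cons_rVS.
  exact: (measurableT_comp (measurable_coord j) measurable_snd).
under eq_fun do rewrite cons_rV0.
exact: measurable_fst.
Qed.

Let uncons_rV n (x : 'rV[R]_n.+1) : R * 'rV[R]_n :=
  (x ord0 ord0, \row_i x ord0 (lift ord0 i)).

Let measurable_uncons_rV n : measurable_fun [set: 'rV[R]_n.+1] (@uncons_rV n).
Proof.
apply/measurable_fun_pairP; split; first exact: measurable_coord.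
apply/measurable_fun_rVP => i /=; under eq_fun do rewrite mxE.
exact: measurable_coord.
Qed.

Let cons_rVK n : cancel (@cons_rV R n) (@uncons_rV n).
Proof.
case=> a v; rewrite /uncons_rV cons_rV0; congr pair.
by apply/rowP => i; rewrite mxE cons_rVS.
Qed.

Definition lebesgue_cons n (mu : {sigma_finite_measure set 'rV[R]_n -> \bar R})
    : set 'rV[R]_n.+1 -> \bar R :=
  pushforward (lebesgue_measure \x mu)%E (@cons_rV R n).

Section lebesgue_cons.
Variables (n : nat) (mu : {sigma_finite_measure set 'rV[R]_n -> \bar R}).

Let lebesgue_cons0 : lebesgue_cons mu set0 = 0%E.
Proof. by rewrite /lebesgue_cons /pushforward preimage_set0 measure0. Qed.

Let lebesgue_cons_ge0 A : (0 <= lebesgue_cons mu A)%E.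
Proof. exact: (measure_ge0 (lebesgue_measure \x mu)%E). Qed.

Let lebesgue_cons_sigma_additive : semi_sigma_additive (lebesgue_cons mu).
Proof.
apply: (@measure_semi_sigma_additive _ _ _
  (pushforward (lebesgue_measure \x mu)%E (@cons_rV R n))).
exact: measurable_cons_rV.
Qed.

HB.instance Definition _ := isMeasure.Build _ _ _ (lebesgue_cons mu)
  lebesgue_cons0 lebesgue_cons_ge0 lebesgue_cons_sigma_additive.

Let sigma_finite_lebesgue_cons : sigma_finite setT (lebesgue_cons mu).
Proof.
have /sigma_finiteP[F [TF ndF Foo]] := sigma_finiteT (@lebesgue_measure R).
have /sigma_finiteP[G [TG ndG Goo]] := sigma_finiteT mu.
exists (fun k => @uncons_rV n @^-1` (F k `*` G k)).
  rewrite -preimage_bigcup (_ : \bigcup_k _ = setT) ?preimage_setT//.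
  rewrite -setXTT TF TG predeqE => -[x y]; split.
    by move=> [k _ []/= ? ?]; split; exists k.
  move=> [/= [i _ Fix] [k _ Gky]]; exists (maxn i k) => //; split.
  - by move: x Fix; exact/subsetPset/ndF/leq_maxl.
  - by move: y Gky; exact/subsetPset/ndG/leq_maxr.
move=> k; have [mF Fk] := Foo k; have [mG Gk] := Goo k; split.
  rewrite -[X in measurable X]setTI.
  by apply: measurable_uncons_rV => //; exact: measurableX.
rewrite /lebesgue_cons /pushforward -comp_preimage (_ : _ \o _ = id).
  by rewrite preimage_id product_measure1E// lte_mul_pinfty// ge0_fin_numE.
exact/funext/cons_rVK.
Qed.

HB.instance Definition _ := Measure_isSigmaFinite.Build _ _ _ (lebesgue_cons mu)
  sigma_finite_lebesgue_cons.

End lebesgue_cons.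

Fixpoint lebesgue_rV n : {sigma_finite_measure set 'rV[R]_n -> \bar R} :=
  match n with
  | 0%N => \d_(0 : 'rV[R]_0)
  | m.+1 => lebesgue_cons (lebesgue_rV m)
  end.

Lemma lebesgue_rV_box n (A : 'I_n -> set R) : (forall i, measurable (A i)) ->
  lebesgue_rV n [set x | forall i, A i (x ord0 i)] =
  (\prod_(i < n) lebesgue_measure (A i))%E.
Proof.
elim: n => [|n IHn] in A * => mA.
  by rewrite big_ord0 /= diracE mem_set// => -[].
rewrite big_ord_recl -IHn//= /lebesgue_cons /pushforward -product_measure1E//.
  congr (_ _); apply/seteqP; split => [[a v] /= Aav|[a v] /= [Aa Av] i].
    split=> [|i]; first by have := Aav ord0; rewrite cons_rV0.
    by have := Aav (lift ord0 i); rewrite cons_rVS.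
  by case: (unliftP ord0 i) => [j ->|->]; rewrite ?cons_rVS ?cons_rV0.
- exact: mA.
- by apply: (@measurable_box R n (fun i => A (lift ord0 i))) => i; exact: mA.
Qed.

End lebesgue_rV.

Section sobolev.
Context {R : realType} {n : nat}.
Implicit Types (Omega : set 'rV[R]_n) (u g phi : 'rV[R]_n -> R).

(* [:: i1; ...; ik] encodes the derivative d_i1 ... d_ik; by the symmetry of
   mixed partial derivatives, only the multi-index matters on smooth functions. *)
Definition partials (s : seq 'I_n) phi : 'rV[R]_n -> R :=
  foldr (fun i psi x => 'D_(delta_mx ord0 i) psi x) phi s.

Definition laplacian phi x : R := \sum_(i < n) partials [:: i; i] phi x.

Definition smooth phi := forall s : seq 'I_n,
  continuous (partials s phi) /\
  forall x i, derivable (partials s phi) x (delta_mx ord0 i).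

Definition closed_support phi : set 'rV[R]_n := closure [set x | phi x != 0].

(* A test function on Omega is extended by 0 to the whole space. *)
Definition test_function Omega phi :=
  [/\ smooth phi, compact (closed_support phi) & closed_support phi `<=` Omega].

(* Elements of L^2_loc(Omega), which are classes of a.e. equal functions, are
   given by Borel representatives; their values outside Omega are irrelevant. *)
Definition L2loc Omega u := measurable_fun Omega u /\
  forall K, compact K -> K `<=` Omega ->
    (\int[lebesgue_rV n]_(x in K) (`|u x| ^+ 2)%:E < +oo)%E.

Definition weak_derivative Omega (s : seq 'I_n) u g :=
  forall phi, test_function Omega phi ->
    \int[lebesgue_rV n]_(x in Omega) (u x * partials s phi x) =
    (-1) ^+ size s * \int[lebesgue_rV n]_(x in Omega) (g x * phi x).

(* W^{k,2}_loc(Omega) *)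
Definition W2loc (k : nat) Omega u := L2loc Omega u /\
  forall s : seq 'I_n, (size s <= k)%N ->
    exists2 g, L2loc Omega g & weak_derivative Omega s u g.

End sobolev.

(* Main.v *)
Require Import Defs.
From mathcomp Require Import all_boot all_order all_algebra.
From mathcomp Require Import all_classical all_reals all_analysis.
From mathcomp Require Import measurable_realfun ring lra.

Set Implicit Arguments.
Unset Strict Implicit.
Unset Printing Implicit Defensive.

Import Order.TTheory GRing.Theory Num.Theory.
Import numFieldNormedType.Exports.

Local Open Scope classical_set_scope.
Local Open Scope ring_scope.

(** Interior regularity for the Laplace equation follows from energy identities,
once the very weak solution has been replaced by smooth functions.

Fix a cube whose ninefold enlargement lies in Omega, extend u by zero outside
that enlargement and convolve it with a product mollifier of width 1/N.  The
result v is smooth on the whole space.  The mollifier centred at a point x of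
the cube is itself a test function, so near the cube the Laplacian of v is the
mollification of f [laplacian_mollify].  By Jensen and Tonelli, the
square integrals of v and of its Laplacian are bounded by those of u and f,
independently of N [mollify_L2].

For smooth v and a compactly supported cutoff chi, the function
chi |grad v|^2 + chi v Lap v - v^2 Lap chi / 2 is a divergence, hence has
integral zero [energy_identity].  This bounds the gradient of v on a smaller
cube by v and Lap v [energy_gradient].  Applied to each partial derivative of
v, with the remaining derivative of Lap v moved away by integration by parts,
it bounds the second derivatives [energy_hessian].  All the bounds are uniform
in N.

Letting N tend to infinity only in the pairing of v with a fixed test function,
one gets, for |s| = 1 or 2 and all test functions phi of the cube,
|int u D_s phi| <= B + (int phi^2) / 4  [functional_bound].
A linear functional l with such a bound is represented by an L^2 function
[riesz_test_functions], namely the limit of a sequence of test functions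
minimising (int phi^2) / 2 - l(phi), which exists by [fast_cauchy_L2_limit].

Finally the representatives found on countably many cubes covering Omega are
glued by a partition of unity [glued_L2loc, glued_weak_derivative]. *)

(** * Partial derivatives of smooth functions *)

Section smooth_calculus.
Context {R : realType} {n : nat}.
Implicit Types (f g : 'rV[R]_n -> R) (i j : 'I_n) (x : 'rV[R]_n).

Notation e_ i := (delta_mx ord0 i : 'rV[R]_n).

Definition pderiv i f : 'rV[R]_n -> R := fun x => 'D_(delta_mx ord0 i) f x.

(** Here the innermost derivative is taken off first, whereas [partials] takes off
the outermost one.  This is the recursion along which the product rule can be
iterated. *)
Fixpoint Ck k f : Prop :=
  match k with
  | 0%N => continuous f
  | k'.+1 => continuous f /\
      forall i, (forall x, derivable f x (e_ i)) /\ Ck k' (pderiv i f)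
  end.

Lemma partials_cons i s f : partials (i :: s) f = pderiv i (partials s f).
Proof. by []. Qed.

Lemma partials_rcons s i f : partials (rcons s i) f = partials s (pderiv i f).
Proof. by rewrite /partials foldr_rcons. Qed.

Lemma smooth_pderiv i f : smooth f -> smooth (pderiv i f).
Proof. by move=> sf s; rewrite -partials_rcons; exact: sf. Qed.

Lemma smooth_partials s f : smooth f -> smooth (partials s f).
Proof. by elim: s => [//|i s IH] sf; apply: smooth_pderiv; exact: IH. Qed.

Lemma smooth_continuous f : smooth f -> continuous f.
Proof. by move=> /(_ [::])[]. Qed.

Lemma smooth_derivable f : smooth f -> forall i x, derivable f x (e_ i).
Proof. by move=> /(_ [::])[_ h] i x; exact: h. Qed.

Lemma smoothP f : smooth f <-> forall k, Ck k f.
Proof.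
split=> [sf k|].
  elim: k f sf => [|k IH] f sf /=; first exact: smooth_continuous.
  split; first exact: smooth_continuous.
  by move=> i; split; [exact: smooth_derivable|exact/IH/smooth_pderiv].
move=> + s; elim/last_ind: s f => [|s i IH] f Cf.
  split; first by have [] := Cf 1%N.
  by move=> x i; have [_ /(_ i)[]] := Cf 1%N.
rewrite partials_rcons; apply: IH => k.
by have [_ /(_ i)[_]] := Cf k.+1.
Qed.

Lemma CkW k f : Ck k.+1 f -> Ck k f.
Proof.
elim: k f => [|k IH] f; first by case.
by move=> [cf df]; split=> // i; have [dfi /IH] := df i; split.
Qed.

Lemma pderiv_cst i (c : R) : pderiv i (fun=> c) = fun=> 0.
Proof. by apply/funext => x; rewrite /pderiv derive_cst. Qed.

Lemma Ck_cst k (c : R) : Ck k (fun=> c).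
Proof.
elim: k c => [|k IH] c /=; first exact: cst_continuous.
split=> [|i]; first exact: cst_continuous.
by rewrite pderiv_cst; split=> [x|]; [exact: derivable_cst|exact: IH].
Qed.

Lemma pderivD i f g : (forall x, derivable f x (e_ i)) ->
  (forall x, derivable g x (e_ i)) ->
  pderiv i (fun x => f x + g x) = fun x => pderiv i f x + pderiv i g x.
Proof. by move=> df dg; apply/funext => x; rewrite /pderiv deriveD. Qed.

Lemma pderivM i f g : (forall x, derivable f x (e_ i)) ->
  (forall x, derivable g x (e_ i)) ->
  pderiv i (fun x => f x * g x) = fun x => f x * pderiv i g x +
    pderiv i f x * g x.
Proof.
move=> df dg; apply/funext => x; rewrite /pderiv.
rewrite (_ : (fun x => _) = f * g)// deriveM//=.
by rewrite /GRing.scale/=; congr (_ + _); rewrite mulrC.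
Qed.

Lemma CkD k f g : Ck k f -> Ck k g -> Ck k (fun x => f x + g x).
Proof.
elim: k f g => [|k IH] f g /=; first by move=> cf cg x;
  exact: (cvgD (cf x) (cg x)).
move=> [cf df] [cg dg]; split=> [x|i]; first exact: (cvgD (cf x) (cg x)).
have [df1 df2] := df i; have [dg1 dg2] := dg i; split.
  by move=> x; apply: derivableD.
by rewrite pderivD//; exact: IH.
Qed.

Lemma CkM k f g : Ck k f -> Ck k g -> Ck k (fun x => f x * g x).
Proof.
elim: k f g => [|k IH] f g; first by move=> cf cg x;
  exact: (cvgM (cf x) (cg x)).
move=> /[dup] /CkW Cf [cf df] /[dup] /CkW Cg [cg dg].
split=> [x|i]; first exact: (cvgM (cf x) (cg x)).
have [df1 df2] := df i; have [dg1 dg2] := dg i; split.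
  by move=> x; apply: derivableM.
by rewrite pderivM//; apply: CkD; apply: IH.
Qed.

Lemma smooth_cst (c : R) : smooth (fun _ : 'rV[R]_n => c).
Proof. by apply/smoothP => k; exact: Ck_cst. Qed.

Lemma smoothD f g : smooth f -> smooth g -> smooth (fun x => f x + g x).
Proof. by move=> /smoothP f1 /smoothP g1; apply/smoothP => k; exact: CkD. Qed.

Lemma smoothM f g : smooth f -> smooth g -> smooth (fun x => f x * g x).
Proof. by move=> /smoothP f1 /smoothP g1; apply/smoothP => k; exact: CkM. Qed.

Lemma smoothZ (c : R) f : smooth f -> smooth (fun x => c * f x).
Proof. by apply: smoothM; exact: smooth_cst. Qed.

Lemma smoothB f g : smooth f -> smooth g -> smooth (fun x => f x - g x).
Proof.
move=> sf /(smoothZ (-1)) sg; have := smoothD sf sg.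
by under eq_fun do rewrite mulN1r.
Qed.

Lemma smooth_sum (I : Type) (r : seq I) (F : I -> 'rV[R]_n -> R) :
  (forall k, smooth (F k)) -> smooth (fun x => \sum_(k <- r) F k x).
Proof.
move=> sF; elim: r => [|k r IH].
  by under eq_fun do rewrite big_nil; exact: (smooth_cst 0).
by under eq_fun do rewrite big_cons; exact: (smoothD (sF k) IH).
Qed.

Lemma smooth_prod (I : Type) (r : seq I) (F : I -> 'rV[R]_n -> R) :
  (forall k, smooth (F k)) -> smooth (fun x => \prod_(k <- r) F k x).
Proof.
move=> sF; elim: r => [|k r IH].
  by under eq_fun do rewrite big_nil; exact: (smooth_cst 1).
by under eq_fun do rewrite big_cons; exact: (smoothM (sF k) IH).
Qed.

Lemma smooth_pderivD i f g : smooth f -> smooth g ->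
  pderiv i (fun x => f x + g x) = fun x => pderiv i f x + pderiv i g x.
Proof. by move=> sf sg; apply: pderivD => x; exact: smooth_derivable. Qed.

Lemma smooth_pderivM i f g : smooth f -> smooth g ->
  pderiv i (fun x => f x * g x) = fun x => f x * pderiv i g x +
    pderiv i f x * g x.
Proof. by move=> sf sg; apply: pderivM => x; exact: smooth_derivable. Qed.

Lemma smooth_partialsD s f g : smooth f -> smooth g ->
  partials s (fun x => f x + g x) = fun x => partials s f x + partials s g x.
Proof.
move=> sf sg; elim: s => [//|i s IH]; rewrite partials_cons IH.
exact: (smooth_pderivD i (smooth_partials s sf) (smooth_partials s sg)).
Qed.

Lemma smooth_partialsZ s (c : R) f : smooth f ->
  partials s (fun x => c * f x) = fun x => c * partials s f x.
Proof.
move=> sf; elim: s => [//|i s IH]; rewrite partials_cons IH.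
rewrite (smooth_pderivM i (smooth_cst c) (smooth_partials s sf)) pderiv_cst.
by apply/funext => x; rewrite mul0r addr0.
Qed.

Lemma smooth_partials_sum s (I : Type) (r : seq I) (F : I -> 'rV[R]_n -> R) :
  (forall k, smooth (F k)) ->
  partials s (fun x => \sum_(k <- r) F k x) =
  fun x => \sum_(k <- r) partials s (F k) x.
Proof.
move=> sF; elim: r => [|k r IH].
  under eq_fun do rewrite big_nil; under [RHS]eq_fun do rewrite big_nil.
  by elim: s => [//|i s IH]; rewrite partials_cons IH pderiv_cst.
under eq_fun do rewrite big_cons; under [RHS]eq_fun do rewrite big_cons.
by rewrite (smooth_partialsD s (sF k) (smooth_sum r sF)) IH.
Qed.

(** Differentiation is local, which is why it does not enlarge supports. *)
Lemma pderiv_near0 i f x : (\forall y \near x, f y = 0) -> pderiv i f x = 0.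
Proof.
move=> f0; rewrite /pderiv (@near_eq_derive R 'rV[R]_n R^o f (cst 0) x _ f0).
exact: derive_cst.
Qed.

End smooth_calculus.

(** * Functions supported in a cube and integration by parts *)

Section boxes.
Context {R : realType} {n : nat}.
Implicit Types (f : 'rV[R]_n -> R) (c x : 'rV[R]_n) (r : R).

Definition box c r : set 'rV[R]_n :=
  [set x | forall i, `[c ord0 i - r, c ord0 i + r]%classic (x ord0 i)].

Definition supp_in c r f := forall x, ~ box c r x -> f x = 0.

Lemma boxP c r x : box c r x <-> forall i, `|x ord0 i - c ord0 i| <= r.
Proof.
by split=> h i; have := h i; rewrite /= in_itv/= ler_distl.
Qed.

Lemma box_compact c r : compact (box c r).
Proof.
apply: (@rV_compact R n (fun i => `[c ord0 i - r, c ord0 i + r]%classic)) => i.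
exact: segment_compact.
Qed.

Lemma box_closed c r : closed (box c r).
Proof.
apply: (@compact_closed _ (box c r) (@norm_hausdorff R 'rV[R]_n)).
exact: box_compact.
Qed.

Lemma box_measurable c r : measurable (box c r).
Proof.
apply: (@measurable_box R n
  (fun i => `[c ord0 i - r, c ord0 i + r]%classic)) => i.
exact: measurable_itv.
Qed.

Lemma box_finite c r : (lebesgue_rV n (box c r) < +oo)%E.
Proof.
rewrite (@lebesgue_rV_box R n
  (fun i => `[c ord0 i - r, c ord0 i + r]%classic)); last first.
  by move=> i; exact: measurable_itv.
rewrite ltey_eq prode_fin_num// => i _.
by rewrite lebesgue_measure_itv/= lte_fin; case: ifP => // _; rewrite -EFinB.
Qed.

Lemma continuous_measurable_rV f : continuous f -> measurable_fun setT f.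
Proof.
move=> /continuousP cf; apply: (measurability _ (RGenOpens.measurableE R)).
move=> _ [_ [a [b ->]] <-]; rewrite setTI; apply: open_measurable_rV.
by apply: cf; exact: interval_open.
Qed.

Lemma supp_bounded c r f : continuous f -> supp_in c r f ->
  exists2 M, 0 <= M & forall x, `|f x| <= M.
Proof.
move=> cf sf.
have : compact (f @` box c r).
  apply: continuous_compact; last exact: box_compact.
  exact: continuous_subspaceT.
move=> /compact_bounded[M [Mr /(_ (`|M| + 1))]].
rewrite (le_lt_trans (ler_norm M)) ?ltrDl// => /(_ isT) hM.
exists (`|M| + 1) => // x; have [bx|nbx] := pselect (box c r x).
  by apply: hM; exists x.
by rewrite sf// normr0.
Qed.

Lemma supp_integrable c r f : continuous f -> supp_in c r f ->
  (lebesgue_rV n).-integrable setT (EFin \o f).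
Proof.
move=> cf sf; have [M M0 fM] := supp_bounded cf sf.
have -> : EFin \o f = (EFin \o f) \_ (box c r).
  apply/funext => x; rewrite patchE; case: ifPn => //.
  by rewrite notin_setE /= => /sf ->.
apply/(integrable_mkcond _ (box_measurable c r)).1.
apply: measurable_bounded_integrable.
- exact: box_measurable.
- exact: box_finite.
- by apply: measurable_funTS; exact: continuous_measurable_rV.
- by exists M; split=> [|N MN x _];
  [exact: num_real|exact: le_trans (fM x) (ltW MN)].
Qed.

Lemma supp_pderiv c r f i : supp_in c r f -> supp_in c r (pderiv i f).
Proof.
move=> sf x nbx; apply: pderiv_near0.
have : open (~` box c r) by apply: closed_openC; exact: box_closed.
by rewrite openE => /(_ x nbx); apply: filterS => y; exact: sf.
Qed.

Lemma supp_partials c r f s : supp_in c r f -> supp_in c r (partials s f).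
Proof. by elim: s => // i s IH sf; apply: supp_pderiv; exact: IH. Qed.

Lemma supp_inMr c r f g : supp_in c r g -> supp_in c r (fun x => f x * g x).
Proof. by move=> sf x /sf ->; rewrite mulr0. Qed.

End boxes.

Section line.
Context {R : realType}.
Notation mu := (@lebesgue_measure R).

(** Both the vanishing of the integral of a compactly supported derivative and the
unit mass of the mollifiers are instances of this form of the fundamental
theorem of calculus. *)
Lemma integral_derive_itv (p p' : R -> R) (a b : R) : a < b ->
  (forall t : R, is_derive t 1 p (p' t)) -> continuous p' ->
  (forall t, t \notin `[a, b] -> p' t = 0) ->
  (\int[mu]_t (p' t)%:E = (p b - p a)%:E)%E.
Proof.
move=> ab p_der cp' p'0.
have cp : continuous p.
  move=> t; apply: differentiable_continuous; apply/derivable1_diffP.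
  by case: (p_der t).
rewrite EFinB -(@continuous_FTC2 _ p')//.
- rewrite [RHS]integral_mkcond; apply: eq_integral => t _.
  rewrite patchE; case: ifPn => //.
  by rewrite notin_setE/= => /negP/p'0 ->.
- exact: continuous_subspaceT.
- split=> [t _||]; first by case: (p_der t).
  + exact/cvg_at_right_filter/cp.
  + exact/cvg_at_left_filter/cp.
- by move=> t _; rewrite derive1E; exact: derive_val.
Qed.

End line.

Section fubini_cons.
Context {R : realType} (n : nat).
Notation mu := (@lebesgue_measure R).

Lemma integrable_cons_rV (f : 'rV[R]_n.+1 -> \bar R) :
  (lebesgue_rV n.+1).-integrable setT f ->
  (mu \x lebesgue_rV n)%E.-integrable setT (f \o @cons_rV R n).
Proof.
move=> /integrableP[mf foo]; apply/integrableP; split.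
  exact: (measurableT_comp mf (@measurable_cons_rV R n)).
move: foo; rewrite /= /lebesgue_cons ge0_integral_pushforward//.
- exact: measurable_cons_rV.
- exact: measurableT_comp.
Qed.

Lemma integral_cons_rV1 (f : 'rV[R]_n.+1 -> \bar R) :
  (lebesgue_rV n.+1).-integrable setT f ->
  (\int[lebesgue_rV n.+1]_x f x =
   \int[mu]_a \int[lebesgue_rV n]_v f (cons_rV (a, v)))%E.
Proof.
move=> /[dup] fi /integrable_cons_rV fi'.
have /integrableP[mf _] := fi.
rewrite /= /lebesgue_cons integral_pushforward//; last first.
  exact: measurable_cons_rV.
by rewrite preimage_setT -integral12_prod_meas1.
Qed.

Lemma integral_cons_rV2 (f : 'rV[R]_n.+1 -> \bar R) :
  (lebesgue_rV n.+1).-integrable setT f ->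
  (\int[lebesgue_rV n.+1]_x f x =
   \int[lebesgue_rV n]_v \int[mu]_a f (cons_rV (a, v)))%E.
Proof.
move=> /[dup] fi /integrable_cons_rV fi'.
rewrite integral_cons_rV1//; exact: (Fubini fi').
Qed.

Lemma ge0_integral_cons_rV (f : 'rV[R]_n.+1 -> \bar R) :
  measurable_fun setT f -> (forall x, 0 <= f x)%E ->
  (\int[lebesgue_rV n.+1]_x f x =
   \int[mu]_a \int[lebesgue_rV n]_v f (cons_rV (a, v)))%E.
Proof.
move=> mf f0; rewrite /= /lebesgue_cons ge0_integral_pushforward//; last first.
  exact: measurable_cons_rV.
rewrite preimage_setT fubini_tonelli1//.
exact: (measurableT_comp mf (@measurable_cons_rV R n)).
by move=> z; exact: f0.
Qed.

End fubini_cons.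

Section divergence.
Context {R : realType}.
Notation mu := (@lebesgue_measure R).

Definition tail_rV n (c : 'rV[R]_n.+1) : 'rV[R]_n :=
  \row_i c ord0 (lift ord0 i).

Lemma box_cons n (c : 'rV[R]_n.+1) r a v : box c r (cons_rV (a, v)) <->
  `[c ord0 ord0 - r, c ord0 ord0 + r]%classic a /\ box (tail_rV c) r v.
Proof.
split=> [bav|[ba bv] i].
  split=> [|i]; first by have := bav ord0; rewrite cons_rV0.
  by have := bav (lift ord0 i); rewrite cons_rVS mxE.
case: (unliftP ord0 i) => [j ->|->]; last by rewrite cons_rV0.
by have := bv j; rewrite cons_rVS mxE.
Qed.

Lemma cons_rV_shift0 n (h a : R) (v : 'rV[R]_n) :
  h *: delta_mx ord0 ord0 + cons_rV (a, v) = cons_rV (h + a, v).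
Proof.
apply/rowP => i; rewrite [LHS]mxE [X in X + _]mxE [X in _ * X + _]mxE.
case: (unliftP ord0 i) => [j ->|->]; first by rewrite !cons_rVS/= mulr0 add0r.
by rewrite !cons_rV0/= mulr1.
Qed.

Lemma cons_rV_shiftS n (h a : R) (v : 'rV[R]_n) (j : 'I_n) :
  h *: delta_mx ord0 (lift ord0 j) + cons_rV (a, v) =
  cons_rV (a, h *: delta_mx ord0 j + v).
Proof.
apply/rowP => i; rewrite [LHS]mxE [X in X + _]mxE [X in _ * X + _]mxE.
case: (unliftP ord0 i) => [k ->|->].
  by rewrite !cons_rVS/= !mxE (inj_eq lift_inj).
by rewrite !cons_rV0/= mulr0 add0r.
Qed.

Lemma cons_rV_continuous1 n (v : 'rV[R]_n) :
  continuous (fun a : R => cons_rV (a, v)).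
Proof.
move=> a; apply/cvg_ballP => e e0.
suff : \forall b \near a, ball (cons_rV (a, v)) e (cons_rV (b, v)) by [].
apply: filterS (@nbhsx_ballx _ _ a e e0) => b ab; split=> // i j.
rewrite (ord1 i); case: (unliftP ord0 j) => [k ->|->].
  by rewrite !cons_rVS/=; exact: ballxx.
by rewrite !cons_rV0.
Qed.

Lemma cons_rV_continuous2 n (a : R) :
  continuous (fun v : 'rV[R]_n => cons_rV (a, v)).
Proof.
move=> v; apply/(@cvg_ballP _ _ _ _ (nbhs_filter (v : 'rV[R]_n))) => e e0.
suff : \forall w \near v, ball (cons_rV (a, v)) e (cons_rV (a, w)) by [].
apply: filterS (@nbhsx_ballx _ _ v e e0) => w [_ vw]; split=> // i j.
rewrite (ord1 i); case: (unliftP ord0 j) => [k ->|->].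
  by rewrite !cons_rVS/=.
by rewrite !cons_rV0/=; exact: ballxx.
Qed.

(** By induction on the dimension.  For the first coordinate, Fubini's theorem puts
the integral along that coordinate inside, where the fundamental theorem of
calculus applies; for any other coordinate the first one is frozen instead. *)
Lemma integral_pderiv0 n (i : 'I_n) (f : 'rV[R]_n -> R) c r : continuous f ->
  (forall x, derivable f x (delta_mx ord0 i)) -> continuous (pderiv i f) ->
  supp_in c r f -> (\int[lebesgue_rV n]_x (pderiv i f x)%:E = 0)%E.
Proof.
elim: n => [|n IH] in i f c *; first by case: i.
move=> cf df cdf sf.
have idf := supp_integrable cdf (supp_pderiv i sf).
case: (unliftP ord0 i) => [j|] ij; rewrite ij in df cdf idf *.
  rewrite integral_cons_rV1//; apply: integral0_eq => a _.
  have dE v : pderiv (lift ord0 j) f (cons_rV (a, v)) =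
      pderiv j (fun w => f (cons_rV (a, w))) v.
    by rewrite /pderiv /derive; under eq_fun do rewrite /= cons_rV_shiftS.
  under eq_integral do rewrite dE.
  apply: (IH _ _ (tail_rV c)).
  - by move=> v; apply: continuous_comp; [exact: cons_rV_continuous2|exact: cf].
  - move=> v; have := df (cons_rV (a, v)); rewrite /derivable.
    by under eq_fun do rewrite /= cons_rV_shiftS.
  - rewrite -(funext dE) => v.
    by apply: continuous_comp; [exact: cons_rV_continuous2|exact: cdf].
  - by move=> v bv; apply: sf => /box_cons[_ /bv].
rewrite integral_cons_rV2//; apply: integral0_eq => v _.
(* The absolute value keeps the interval nondegenerate when r is negative; one
unit beyond M the function is already 0. *)
pose M := `|r| + 1.
have pM : c ord0 ord0 - M < c ord0 ord0 + M.
  by rewrite ltrBlDr -addrA ltrDl addr_gt0// ltr_wpDl.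
have out t : t \notin `[c ord0 ord0 - M, c ord0 ord0 + M] ->
    ~ box c r (cons_rV (t, v)).
  move=> /negP tM /box_cons[/= tr _]; apply: tM.
  move: tr; rewrite !in_itv/= -!ler_distl => /le_trans; apply.
  by rewrite (le_trans (ler_norm r))// lerDl.
pose p a := f (cons_rV (a, v)).
pose p' a := pderiv ord0 f (cons_rV (a, v)).
have pe : p (c ord0 ord0 + (M + 1)) - p (c ord0 ord0 - (M + 1)) = 0.
  have -> : p (c ord0 ord0 + (M + 1)) = 0.
    apply/sf/out; rewrite in_itv/= negb_and; apply/orP; right.
    by rewrite -ltNge ltrD2l ltrDl.
  have -> : p (c ord0 ord0 - (M + 1)) = 0.
    apply/sf/out; rewrite in_itv/= negb_and; apply/orP; left.
    by rewrite -ltNge ltrD2l ltrN2 ltrDl.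
  by rewrite subr0.
apply: etrans (@integral_derive_itv _ p p' (c ord0 ord0 - (M + 1))
  (c ord0 ord0 + (M + 1)) _ _ _ _) _; last by rewrite pe.
- by apply: (lt_trans _ (lt_trans pM _)); rewrite ltrD2l ?ltrN2 ltrDl.
- move=> t; have := df (cons_rV (t, v)).
  have dpE : pderiv ord0 f (cons_rV (t, v)) = 'D_1 p t.
    rewrite /pderiv /derive; under eq_fun do rewrite /= cons_rV_shift0.
    by under [in RHS]eq_fun do rewrite /= scaler1.
  move=> dft; apply: DeriveDef; last by rewrite /p' dpE.
  move: dft; rewrite /derivable.
  under eq_fun do rewrite /= cons_rV_shift0.
  by under [X in _ -> cvg (X @ _)]eq_fun do rewrite /= scaler1.
- by move=> t; apply: continuous_comp; [exact: cons_rV_continuous1|exact: cdf].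
- move=> t tM; apply: supp_pderiv sf _ _; apply: out; apply: contra tM.
  rewrite !in_itv/= -!ler_distl => /le_trans; apply; by rewrite lerDl.
Qed.

Lemma Rintegral_pderiv0 n (i : 'I_n) (f : 'rV[R]_n -> R) c r : smooth f ->
  supp_in c r f -> \int[lebesgue_rV n]_x pderiv i f x = 0.
Proof.
move=> sf scf; rewrite /Rintegral (integral_pderiv0 _ _ _ scf)//.
- exact: smooth_continuous.
- exact: smooth_derivable.
- exact/smooth_continuous/smooth_pderiv.
Qed.

Lemma smooth_integrable n (f : 'rV[R]_n -> R) c r : smooth f ->
  supp_in c r f -> (lebesgue_rV n).-integrable setT (EFin \o f).
Proof. by move=> /smooth_continuous cf; exact: supp_integrable. Qed.

Lemma integration_by_parts_rV n (i : 'I_n) (f g : 'rV[R]_n -> R) c r :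
  smooth f -> smooth g -> supp_in c r g ->
  \int[lebesgue_rV n]_x (f x * pderiv i g x) =
  - \int[lebesgue_rV n]_x (pderiv i f x * g x).
Proof.
move=> sf sg cg; apply/eqP; rewrite -addr_eq0; apply/eqP.
have i1 := smooth_integrable (smoothM sf (smooth_pderiv i sg))
  (supp_inMr f (supp_pderiv i cg)).
have i2 := smooth_integrable (smoothM (smooth_pderiv i sf) sg)
  (supp_inMr (pderiv i f) cg).
rewrite -(RintegralD measurableT i1 i2).
rewrite -[RHS](Rintegral_pderiv0 i (smoothM sf sg) (supp_inMr f cg)).
by rewrite (smooth_pderivM i sf sg).
Qed.

(** Each integration by parts moves the outermost derivative of g onto f, so that
the derivatives reach f in the opposite order. *)
Lemma integral_partials_rV n (s : seq 'I_n) (f g : 'rV[R]_n -> R) c r :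
  smooth f -> smooth g -> supp_in c r g ->
  \int[lebesgue_rV n]_x (f x * partials s g x) =
  (-1) ^+ size s * \int[lebesgue_rV n]_x (partials (rev s) f x * g x).
Proof.
elim: s f => [|i s IH] f sf sg cg; first by rewrite expr0 mul1r.
rewrite partials_cons.
rewrite (integration_by_parts_rV i sf (smooth_partials s sg)
  (supp_partials s cg)).
rewrite (IH _ (smooth_pderiv i sf) sg cg) -partials_rcons -rev_cons.
by rewrite [size (i :: s)]/= exprS mulN1r mulNr.
Qed.

End divergence.

(** * A smooth step on the line *)

Section smooth1.
Context {R : realType}.
Implicit Types (p q : R -> R).

(** Stating the derivative as a witness lets each rule of calculus supply it
explicitly in the inductions below. *)
Fixpoint derivable_upto k p : Prop :=
  if k is k'.+1 then
    exists2 p', (forall t : R, is_derive t 1 p (p' t)) & derivable_upto k' p'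
  else True.

Definition smooth1 p := forall k, derivable_upto k p.

Lemma derivable_uptoW k p : derivable_upto k.+1 p -> derivable_upto k p.
Proof. by elim: k p => [//|k IH] p [p' dp /IH]; exists p'. Qed.

Lemma derivable_upto_cst k (c : R) : derivable_upto k (fun=> c).
Proof.
by elim: k c => [//|k IH] c; exists (fun=> 0) => // t; exact: is_derive_cst.
Qed.

Lemma derivable_uptoD k p q : derivable_upto k p -> derivable_upto k q ->
  derivable_upto k (fun t => p t + q t).
Proof.
elim: k p q => [//|k IH] p q [p' dp Dp] [q' dq Dq].
by exists (fun t => p' t + q' t); [move=> t; exact: is_deriveD|exact: IH].
Qed.

Lemma derivable_uptoM k p q : derivable_upto k p -> derivable_upto k q ->
  derivable_upto k (fun t => p t * q t).
Proof.
elim: k p q => [//|k IH] p q /[dup] /derivable_uptoW Dp [p' dp Dp'] /[dup]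
  /derivable_uptoW Dq [q' dq Dq'].
exists (fun t => p t * q' t + q t * p' t); first by move=> t; exact: is_deriveM.
by apply: derivable_uptoD; apply: IH.
Qed.

Lemma is_derive_comp_affine (p p' : R -> R) (a b : R) :
  (forall t : R, is_derive t 1 p (p' t)) ->
  forall t : R, is_derive t 1 (fun t => p (a * t + b)) (a * p' (a * t + b)).
Proof.
move=> dp t; rewrite mulrC.
apply: (@is_derive1_comp _ p (fun t => a * t + b)).
have dZ : is_derive t 1 (fun t : R => a * t) (a *: 1).
  exact: (is_deriveZ a (is_derive_id t (1 : R))).
have dC : is_derive t 1 (fun _ : R => b) 0 by exact: is_derive_cst.
apply: (is_derive_eq (is_deriveD dZ dC)).
by rewrite addr0 /GRing.scale/= mulr1.
Qed.

Lemma derivable_upto_affine k p (a b : R) : derivable_upto k p ->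
  derivable_upto k (fun t => p (a * t + b)).
Proof.
elim: k p => [//|k IH] p [p' dp Dp].
exists (fun t => a * p' (a * t + b)); first exact: is_derive_comp_affine.
by apply: derivable_uptoM; [exact: derivable_upto_cst|exact: IH].
Qed.

Lemma derivable_uptoV k p : (forall t, p t != 0) -> derivable_upto k p ->
  derivable_upto k (fun t => (p t)^-1).
Proof.
move=> p0; elim: k => [//|k IH] /[dup] /derivable_uptoW Dp [p' dp Dp'].
exists (fun t => (-1) * ((p t)^-1 * (p t)^-1) * p' t).
  move=> t; have -> : -1 * ((p t)^-1 / p t) * p' t = - p t ^- 2 *: p' t.
    by rewrite mulN1r -invfM -expr2.
  exact: is_deriveV.
apply: derivable_uptoM => //; apply: derivable_uptoM;
  first exact: derivable_upto_cst.
by apply: derivable_uptoM; exact: IH.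
Qed.

Lemma smooth1_derive p : smooth1 p -> forall t :
  R, is_derive t 1 p (derive1 p t).
Proof.
move=> /(_ 1%N)[p' dp _] t; have dpt := dp t.
by rewrite derive1E derive_val.
Qed.

Lemma smooth1_derive1 p : smooth1 p -> smooth1 (derive1 p).
Proof.
move=> sp k; have [p' dp Dp] := sp k.+1.
have -> // : derive1 p = p'.
by apply/funext => t; have dpt := dp t; rewrite derive1E derive_val.
Qed.

Lemma smooth1_derive1n p m : smooth1 p -> smooth1 (derive1n m p).
Proof. by elim: m p => [//|m IH] p /smooth1_derive1 /IH; rewrite derive1Sn. Qed.

End smooth1.

Section step.
Context {R : realType}.

(** The functions t^-m exp (-1/t) span a space closed under differentiation, and
this is how exp (-1/t) is seen to be smooth at 0. *)
Definition expinv (m : nat) (t : R) : R :=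
  if 0 < t then t^-1 ^+ m * expR (- t^-1) else 0.

(** This is exp s >= s^(m+1) / (m+1)! at s = 1/t. *)
Lemma expinv_le m (t : R) : 0 <= expinv m t <= (m.+1)`!%:R * `|t|.
Proof.
rewrite /expinv; case: ifPn => [t0|_]; last by rewrite lexx mulr_ge0.
rewrite mulr_ge0 ?expR_ge0 ?exprn_ge0 ?invr_ge0 ?(ltW t0)//=.
have ti0 : 0 <= t^-1 by rewrite invr_ge0 ltW.
have := expR_ge1Dxn m ti0.
move=> /(le_trans (ler_wpDl ler01 (lexx _))).
rewrite ler_pdivrMr ?ltr0n ?fact_gt0// => h.
rewrite expRN ler_pdivrMr ?expR_gt0// gtr0_norm//.
rewrite -(@ler_pM2l _ t^-1) ?invr_gt0// -exprS (le_trans h)//.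
rewrite le_eqVlt; apply/orP; left; apply/eqP.
by field; rewrite gt_eqF.
Qed.

(** At 0 the difference quotient of [expinv m] is [expinv m.+1], which tends to 0
by [expinv_le]. *)
Lemma expinv_derive m (t : R) :
  is_derive t 1 (expinv m) (- m%:R * expinv m.+1 t + expinv m.+2 t).
Proof.
have [t0|t0|<-] := ltgtP 0 t.
- apply: (@near_eq_is_derive R R^o R^o (fun t => t^-1 ^+ m * expR (- t^-1))).
    near=> s; rewrite /expinv ifT//.
    near: s; exact: lt_nbhsr.
  have tn0 : t != 0 by rewrite gt_eqF.
  have dV : is_derive t 1 (fun t : R => t^-1) (- t ^- 2 *: 1).
    exact: (is_deriveV tn0 (is_derive_id t (1 : R))).
  have : is_derive t 1 ((fun t : R => t^-1) ^+ m) _ := is_deriveX m dV.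
  rewrite exprfctE => dX.
  have dE : is_derive t 1 (fun t : R => expR (- t^-1)) (expR (- t^-1) * t ^- 2).
    apply: (@is_derive1_comp _ expR (fun t => - t^-1)).
    have -> : t ^- 2 = - (- t ^- 2 *: 1) by rewrite scaleNr opprK
      /GRing.scale/= mulr1.
    exact: is_deriveN.
  apply: (is_derive_eq (is_deriveM dX dE)).
  rewrite /expinv t0 /GRing.scale/=.
  case: m {dX} => [|m]; first by rewrite mulr0n !mul0r; field.
  by rewrite -!exprVn /= !exprS expr0; ring.
- apply: (@near_eq_is_derive R R^o R^o (cst 0)).
    near=> s; rewrite /expinv ifF//; apply/negbTE; rewrite -leNgt ltW//.
    near: s; exact: lt_nbhsl.
  rewrite /expinv ltNge (ltW t0)/= mulr0 addr0; exact: is_derive_cst.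
rewrite /expinv ltxx mulr0 addr0.
have H : h^-1 *: ((expinv m \o shift 0) (h *: 1) - expinv m 0)
    @[h --> (0 : R)^'] --> (0 : R).
  have n0 : (m.+2)`!%:R * `|h| @[h --> (0 : R)^'] --> (0 : R).
    have n1 : `|h| @[h --> (0 : R)^'] --> `|0 : R|.
      by apply: cvg_norm; exact: cvg_within.
    rewrite normr0 in n1.
    have n2 : (fun _ : R => (m.+2)`!%:R : R) @ (0 : R)^' --> ((m.+2)`!%:R : R).
      exact: cvg_cst.
    by have := cvgM n2 n1; rewrite mulr0; apply.
  apply: (@squeeze_cvgr _ _ _ _ (fun h : R => - ((m.+2)`!%:R * `|h|))
    (fun h => (m.+2)`!%:R * `|h|)) => //.
    near=> h.
    have h0 : h != 0 by near: h; exact: nbhs_dnbhs_neq.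
    rewrite -ler_norml /= addr0 /GRing.scale/= mulr1.
    rewrite {2}/expinv ltxx subr0.
    have /andP[e0 e1] := expinv_le m.+1 h.
    suff -> : h^-1 * expinv m h = expinv m.+1 h by rewrite ger0_norm.
    by rewrite /expinv; case: ifP => _; rewrite ?mulr0// mulrA -exprS.
  by have := cvgN n0; rewrite oppr0; apply.
apply: DeriveDef; first by apply/cvg_ex; exists 0.
exact: cvg_lim H.
Unshelve. all: by end_near. Qed.

Lemma smooth1_expinv m : smooth1 (expinv m).
Proof.
move=> k; elim: k m => [//|k IH] m.
exists (fun t => - m%:R * expinv m.+1 t + expinv m.+2 t).
  by move=> t; exact: expinv_derive.
by apply: derivable_uptoD => //; apply: derivable_uptoM => //;
  exact: derivable_upto_cst.
Qed.

Lemma expinv_ge0 m t : 0 <= expinv m t.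
Proof. by have /andP[] := expinv_le m t. Qed.

Lemma expinv_gt0 m t : 0 < t -> 0 < expinv m t.
Proof.
by move=> t0; rewrite /expinv t0 mulr_gt0 ?expR_gt0// exprn_gt0 ?invr_gt0.
Qed.

Lemma expinv0 m t : t <= 0 -> expinv m t = 0.
Proof. by move=> t0; rewrite /expinv ltNge t0. Qed.

(** The argument 1 - t is written as a t + b, the form of [derivable_upto_affine]. *)
Definition step (t : R) : R :=
  expinv 0 t / (expinv 0 t + expinv 0 (-1 * t + 1)).

Lemma step_den t : 0 < expinv 0 t + expinv 0 (-1 * t + 1).
Proof.
have [t0|t0] := ltP 0 t; first by rewrite ltr_pwDl ?expinv_gt0 ?expinv_ge0.
by rewrite ltr_wpDl ?expinv_ge0 ?expinv_gt0//; lra.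
Qed.

Lemma smooth1_step : smooth1 step.
Proof.
move=> k; apply: derivable_uptoM; first exact: smooth1_expinv.
apply: derivable_uptoV; first by move=> t; rewrite gt_eqF// step_den.
by apply: derivable_uptoD; [|apply: derivable_upto_affine];
  exact: smooth1_expinv.
Qed.

Lemma step0 t : t <= 0 -> step t = 0.
Proof. by move=> t0; rewrite /step expinv0// mul0r. Qed.

Lemma step1 t : 1 <= t -> step t = 1.
Proof.
move=> t1; rewrite /step (@expinv0 _ (_ + 1)) ?addr0 ?divff//; last by lra.
by rewrite gt_eqF// expinv_gt0// (lt_le_trans ltr01).
Qed.

Lemma step_ge0 t : 0 <= step t.
Proof. by rewrite divr_ge0 ?(ltW (step_den t))// expinv_ge0. Qed.

Lemma step_le1 t : step t <= 1.
Proof. by rewrite ler_pdivrMr ?step_den// mul1r lerDl expinv_ge0. Qed.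

(** With p = expinv 0 t, q = expinv 0 (1 - t) and b' = expinv 2 (1 - t), the
derivative of p / (p + q) has numerator p' q + p b', a sum of nonnegative
terms. *)
Lemma step_derive_ge0 t : 0 <= derive1 step t.
Proof.
pose a' := expinv 2 t; pose b' := expinv 2 (-1 * t + 1).
have D0 := step_den t; set D := _ + _ in D0.
have de (z : R) : is_derive z 1 (expinv 0) (expinv 2 z).
  by apply: (is_derive_eq (expinv_derive 0 z)); rewrite oppr0 mul0r add0r.
have da : is_derive t 1 (expinv 0) a' := de t.
have db : is_derive t 1 (fun t => expinv 0 (-1 * t + 1)) (-1 * b').
  exact: (is_derive_comp_affine (-1) 1 de t).
have dD := is_deriveD da db.
have Dn0 : D != 0 by rewrite gt_eqF.
have dV := @is_deriveV R (fun t => expinv 0 t + expinv 0 (-1 * t + 1)) t _ 1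
  Dn0 dD.
have dS := is_deriveM da dV.
have -> : derive1 step t = (a' * expinv 0 (-1 * t + 1) + expinv 0 t * b') / D
  ^+ 2.
  rewrite derive1E (_ : step = expinv 0 *
    (fun t => (expinv 0 t + expinv 0 (-1 * t + 1))^-1))//.
  rewrite derive_val /GRing.scale/=.
  have -> : a' * expinv 0 (-1 * t + 1) = a' * (D - expinv 0 t).
    by rewrite /D addrAC subrr add0r.
  by rewrite -/D; field.
by rewrite divr_ge0 ?exprn_ge0 ?(ltW D0)// addr_ge0// mulr_ge0// expinv_ge0.
Qed.

Lemma derive_supp_itv (p : R -> R) (a b : R) :
  (forall t, t \notin `[a, b] -> p t = 0) ->
  forall t, t \notin `[a, b] -> derive1 p t = 0.
Proof.
move=> p0 t tab; rewrite derive1E.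
rewrite (@near_eq_derive R R^o R^o p (cst 0)) ?derive_cst//.
have : open (~` [set` `[a, b]]) by apply: closed_openC; exact: interval_closed.
by rewrite openE => /(_ t (negP tab)); apply: filterS => y /negP; exact: p0.
Qed.

Lemma step_derive_supp m t : t \notin `[0, 1] -> derive1n m.+1 step t = 0.
Proof.
elim: m t => [|m IH] t t01; last first.
  by rewrite derive1nS; apply: (@derive_supp_itv _ 0 1).
rewrite derive1n1 derive1E; have : (t < 0) || (1 < t).
  by move: t01; rewrite in_itv/= negb_and -!ltNge.
case/orP => t0.
- rewrite (@near_eq_derive R R^o R^o _ (cst 0)) ?derive_cst//.
  by near=> s; rewrite step0//; apply: ltW; near: s; exact: lt_nbhsl.
- rewrite (@near_eq_derive R R^o R^o _ (cst 1)) ?derive_cst//.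
  by near=> s; rewrite step1//; apply: ltW; near: s; exact: lt_nbhsr.
Unshelve. all: by end_near. Qed.

End step.

(** * Approximate identity and plateau functions on the line *)

Section kernel1.
Context {R : realType}.
Notation mu := (@lebesgue_measure R).

(** The derivative of order m.+1 of t |-> step (N t).  For m = 0 it is a
nonnegative function of integral 1 supported in [0, 1/N], and the other values
of m give its derivatives. *)
Definition step_kernel (N : R) (m : nat) (t : R) : R :=
  N ^+ m.+1 * derive1n m.+1 step (N * t).

Lemma step_jet m (t : R) :
  is_derive t 1 (derive1n m (@step R)) (derive1n m.+1 step t).
Proof.
have h := smooth1_derive1n m (@smooth1_step R).
have := smooth1_derive h t; by rewrite derive1nS.
Qed.

Lemma step_kernel_derive N m (t : R) :
  is_derive t 1 (step_kernel N m) (step_kernel N m.+1 t).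
Proof.
have h := is_derive_comp_affine N 0 (step_jet m.+1) t.
have hZ := is_deriveZ (N ^+ m.+1) h.
rewrite (_ : step_kernel N m =
  N ^+ m.+1 \*: (fun t => derive1n m.+1 step (N * t + 0))).
  apply: (is_derive_eq hZ); have -> : N * t + 0 = N * t by rewrite addr0.
  rewrite /step_kernel /GRing.scale/=.
  by rewrite mulrA -exprSr.
by apply/funext => s; rewrite /step_kernel /= addr0.
Qed.

Lemma is_derive_continuous (p p' : R -> R) :
  (forall t : R, is_derive t 1 p (p' t)) -> continuous p.
Proof.
move=> dp t; apply: differentiable_continuous; apply/derivable1_diffP.
by case: (dp t).
Qed.

Lemma step_kernel_continuous N m : continuous (step_kernel N m).
Proof. exact: is_derive_continuous (step_kernel_derive N m). Qed.

Lemma step_kernel_ge0 N t : 0 <= N -> 0 <= step_kernel N 0 t.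
Proof.
by move=> N0; rewrite mulr_ge0 ?exprn_ge0// derive1n1 step_derive_ge0.
Qed.

Lemma step_kernel_supp N m t : 0 < N -> ~~ (0 <= t <= N^-1) ->
  step_kernel N m t = 0.
Proof.
move=> N0 tN; rewrite /step_kernel step_derive_supp ?mulr0//.
apply: contra tN; rewrite in_itv/= pmulr_rge0// => /andP[-> /=].
by rewrite -ler_pdivlMl// mulr1.
Qed.

Lemma step_kernel_bounded N m : 0 < N ->
  exists2 M, 0 <= M & forall t, `|step_kernel N m t| <= M.
Proof.
move=> N0; have : compact (step_kernel N m @` `[0, N^-1]).
  apply: continuous_compact; last exact: segment_compact.
  by apply: continuous_subspaceT; exact: step_kernel_continuous.
move=> /compact_bounded[M [Mr /(_ (`|M| + 1))]].
rewrite (le_lt_trans (ler_norm M)) ?ltrDl// => /(_ isT) hM.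
exists (`|M| + 1) => // t; have [bx|nbx] := boolP (0 <= t <= N^-1).
  by apply: hM; exists t => //=; rewrite in_itv.
by rewrite step_kernel_supp// normr0.
Qed.

Lemma step_kernel_sub_derive N m (a t : R) :
  is_derive t 1 (fun t => step_kernel N m (t - a)) (step_kernel N m.+1 (t - a)).
Proof.
have := is_derive_comp_affine 1 (- a) (step_kernel_derive N m) t.
rewrite !mul1r (_ : (fun t => _) = (fun t => step_kernel N m (t - a)))//.
by apply/funext => s; rewrite mul1r.
Qed.

Lemma step_kernel_integral N (a : R) : 0 < N ->
  (\int[mu]_t (step_kernel N 0 (t - a))%:E = 1)%E.
Proof.
move=> N0.
have dp : forall t : R, is_derive t 1 (fun t => step (N * t + (- (N * a))))
                                (step_kernel N 0 (t - a)).
  move=> t; have := is_derive_comp_affine N (- (N * a)) (step_jet 0) t.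
  by rewrite /step_kernel expr1 mulrBr.
have ab : a < a + N^-1 by rewrite ltrDl invr_gt0.
have -> : 1%E = (step (N * (a + N^-1) + - (N * a)) -
  step (N * a + - (N * a)))%:E.
  rewrite subrr mulrDr divff ?gt_eqF// addrAC subrr add0r.
  by rewrite step1// step0// subr0.
apply: (integral_derive_itv ab) dp _ _.
- exact: is_derive_continuous (step_kernel_sub_derive N 0 a).
- move=> t tab; apply: step_kernel_supp => //; apply: contra tab.
  by rewrite in_itv/= subr_ge0 lerBlDr addrC.
Qed.

(** The signs make the reflected kernels successive derivatives of one another. *)
Lemma step_kernel_rev_derive N m (a t : R) :
  is_derive t 1 (fun t => (-1) ^+ m * step_kernel N m (a - t))
                ((-1) ^+ m.+1 * step_kernel N m.+1 (a - t)).
Proof.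
have h := is_derive_comp_affine (-1) a (step_kernel_derive N m) t.
have hZ := is_deriveZ ((-1) ^+ m) h.
rewrite (_ : (fun t => _) = (-1) ^+ m \*:
  (fun t => step_kernel N m (-1 * t + a))).
  apply: (is_derive_eq hZ); have -> :
    -1 * t + a = a - t by rewrite mulN1r addrC.
  by rewrite /GRing.scale/= mulrA exprSr.
apply/funext => s /=; have -> // : -1 * s + a = a - s by rewrite mulN1r addrC.
Qed.

(** Equal to 1 within distance r of a, and to 0 beyond distance 2 r. *)
Definition plateau (a r t : R) : R :=
  step (r^-1 * t + (2 - r^-1 * a)) * step (- r^-1 * t + (2 + r^-1 * a)).

Lemma smooth1_plateau a r : smooth1 (plateau a r).
Proof.
by move=> k; apply: derivable_uptoM; apply: derivable_upto_affine;
  exact: smooth1_step.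
Qed.

Lemma plateau_ge0 a r t : 0 <= plateau a r t.
Proof. by rewrite mulr_ge0// step_ge0. Qed.

Lemma plateau_le1 a r t : plateau a r t <= 1.
Proof. by rewrite mulr_ile1// ?step_ge0 ?step_le1. Qed.

Lemma plateau1 a r t : 0 < r -> `|t - a| <= r -> plateau a r t = 1.
Proof.
move=> r0; rewrite -(@ler_pM2l _ r^-1) ?invr_gt0// mulVf ?gt_eqF//.
rewrite -[X in X * `|_|](@ger0_norm _ r^-1) ?invr_ge0 ?(ltW r0)// -normrM
  mulrBr.
by rewrite ler_norml => /andP[h1 h2]; rewrite /plateau !step1 ?mulr1//; lra.
Qed.

Lemma plateau0 a r t : 0 < r -> 2 * r < `|t - a| -> plateau a r t = 0.
Proof.
move=> r0; rewrite -(@ltr_pM2l _ r^-1) ?invr_gt0// mulrCA mulVf ?gt_eqF// mulr1.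
rewrite -[X in X * `|_|](@ger0_norm _ r^-1) ?invr_ge0 ?(ltW r0)// -normrM
  mulrBr.
rewrite ltr_normr => /orP[h|h]; rewrite /plateau.
  by rewrite [X in _ * X]step0 ?mulr0//; lra.
by rewrite [X in X * _]step0 ?mul0r//; lra.
Qed.

End kernel1.

(** * Products of functions of one coordinate *)

Section product_functions.
Context {R : realType} {n : nat}.
Implicit Types (b : 'I_n -> R -> R) (x y : 'rV[R]_n) (i k : 'I_n).

Definition prodf b x : R := \prod_(k < n) b k (x ord0 k).

Lemma continuous_prod_rV (I : Type) (r : seq I) (P : pred I)
    (F : I -> 'rV[R]_n -> R) :
  (forall k : I, continuous (F k)) ->
    continuous (fun x => \prod_(k <- r | P k) F k x).
Proof.
move=> cF; elim: r => [|k r IH].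
  by under eq_fun do rewrite big_nil; exact: cst_continuous.
under eq_fun do rewrite big_cons; case: (P k) => // x.
exact: (cvgM (cF k x) (IH x)).
Qed.

Lemma prodf_continuous b : (forall k, continuous (b k)) -> continuous (prodf b).
Proof.
move=> cb; apply: continuous_prod_rV => k x.
by apply: continuous_comp; [exact: coord_continuous|exact: cb].
Qed.

Lemma prodf_line b i (h : R) x :
  prodf b (h *: delta_mx ord0 i + x) =
  b i (h + x ord0 i) * \prod_(k < n | k != i) b k (x ord0 k).
Proof.
rewrite /prodf (bigD1 i)//= !mxE !eqxx/= mulr1; congr (_ * _).
by apply: eq_bigr => k ki; rewrite !mxE (negPf ki) andbF mulr0 add0r.
Qed.

Lemma prodf_split b i x :
  prodf b x = b i (x ord0 i) * \prod_(k < n | k != i) b k (x ord0 k).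
Proof. by rewrite /prodf (bigD1 i). Qed.

Lemma prodf_is_derive b i (b' : R -> R) x :
  (forall t : R, is_derive t 1 (b i) (b' t)) ->
  is_derive x (delta_mx ord0 i) (prodf b)
    (b' (x ord0 i) * \prod_(k < n | k != i) b k (x ord0 k)).
Proof.
move=> db; set C := \prod_(k < n | k != i) _.
have dC : is_derive (x ord0 i) 1 (fun t => b i t * C) (b' (x ord0 i) * C).
  have h := is_deriveZ C (db (x ord0 i)).
  rewrite (_ : (fun t => b i t * C) = C \*: b i).
    by apply: (is_derive_eq h); rewrite /GRing.scale/= mulrC.
  by apply/funext => t; rewrite /= /GRing.scale/= mulrC.
have e : (fun h : R => h^-1 *:
  ((prodf b \o shift x) (h *: delta_mx ord0 i) - prodf b x)) =
  (fun h : R => h^-1 *: (((fun t => b i t * C) \o shift (x ord0 i)) (h *: 1) -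
    b i (x ord0 i) * C)).
  by apply/funext => h; rewrite /= prodf_line
    (prodf_split b i x) /GRing.scale/= mulr1.
case: dC => dC1 dC2; apply: DeriveDef; first by rewrite /derivable e.
by rewrite /derive e.
Qed.

Lemma pderiv_prodf b i (b' : R -> R) :
  (forall t : R, is_derive t 1 (b i) (b' t)) ->
  pderiv i (prodf b) = prodf (fun k => if k == i then b' else b k).
Proof.
move=> db; apply/funext => x; have h := prodf_is_derive x db.
rewrite /pderiv derive_val (prodf_split _ i) eqxx; congr (_ * _).
by apply: eq_bigr => k /negPf ->.
Qed.

(** When B k m is the m-th derivative of B k 0, the derivative of index s of the
product of the B k 0 only depends on the number of occurrences of each
coordinate in s.  Smoothness and the commutation of mixed derivatives are
read off this formula. *)
Section jets.
Variable B : 'I_n -> nat -> R -> R.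
Hypothesis dB : forall k m (t : R), is_derive t 1 (B k m) (B k m.+1 t).

Definition pjet (s : seq 'I_n) := prodf (fun k => B k (count_mem k s)).

Lemma pderiv_pjet i s : pderiv i (pjet s) = pjet (i :: s).
Proof.
rewrite /pjet (pderiv_prodf (fun t => dB i (count_mem i s) t)).
congr prodf; apply/funext => k; rewrite /= (eq_sym i k).
by case: eqP => [->|_]; rewrite ?add1n ?add0n.
Qed.

Lemma partials_pjet s : partials s (pjet [::]) = pjet s.
Proof. by elim: s => [//|i s IH]; rewrite -pderiv_pjet -IH. Qed.

Lemma pjet_continuous s : continuous (pjet s).
Proof.
by apply: prodf_continuous => k; exact: is_derive_continuous (@dB _ _).
Qed.

Lemma pjet_smooth : smooth (pjet [::]).
Proof.
move=> s; rewrite partials_pjet; split; first exact: pjet_continuous.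
move=> x i; have [] // := @prodf_is_derive (fun k => B k (count_mem k s)) i _ x
  (@dB i (count_mem i s)).
Qed.

End jets.

(** The product in which all the factors but one are constant. *)
Lemma smooth_coord (p : R -> R) i : smooth1 p -> smooth (fun x => p (x ord0 i)).
Proof.
move=> sp; pose B k m : R -> R := if k == i then derive1n m p
  else (fun=> (m == 0%N)%:R).
have dB k m (t : R) : is_derive t 1 (B k m) (B k m.+1 t).
  rewrite /B; case: (k == i); last exact: is_derive_cst.
  by have := smooth1_derive (smooth1_derive1n m sp) t; rewrite derive1nS.
have := pjet_smooth dB; congr (smooth _); apply/funext => x.
rewrite /pjet (prodf_split _ i) /B eqxx /= big1 ?mulr1// => k ki.
by rewrite (negPf ki).
Qed.

(** A smooth function equal to 1 on the cube of radius r and to 0 off the cube of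
radius 2 r. *)
Definition cutoff (c : 'rV[R]_n) (r : R) : 'rV[R]_n -> R :=
  fun x => \prod_(k < n) plateau (c ord0 k) r (x ord0 k).

Lemma cutoff_smooth c r : smooth (cutoff c r).
Proof.
by apply: smooth_prod => k; apply: smooth_coord; exact: smooth1_plateau.
Qed.

Lemma cutoff_ge0 c r x : 0 <= cutoff c r x.
Proof. by apply: prodr_ge0 => k _; exact: plateau_ge0. Qed.

Lemma cutoff_le1 c r x : cutoff c r x <= 1.
Proof. by apply: prodr_ile1 => k; rewrite plateau_ge0 plateau_le1. Qed.

Lemma cutoff1 c r x : 0 < r -> box c r x -> cutoff c r x = 1.
Proof.
by move=> r0 /boxP bx; rewrite /cutoff big1// => k _; rewrite plateau1.
Qed.

Lemma cutoff_supp c r : 0 < r -> supp_in c (2 * r) (cutoff c r).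
Proof.
move=> r0 x nb; have [k hk] : exists k, 2 * r < `|x ord0 k - c ord0 k|.
  apply: contrapT => /forallNP h; apply: nb; apply/boxP => k.
  by rewrite leNgt; apply/negP; exact: h.
by rewrite /cutoff (bigD1 k)//= plateau0// mul0r.
Qed.

End product_functions.

Section mollifier.
Context {R : realType} {n : nat}.
Implicit Types (x y : 'rV[R]_n) (s : seq 'I_n).
Variable (N : R) (N0 : 0 < N).

(** The derivative of index s, with respect to x, of a mollifier of width 1/N
evaluated at x - y. *)
Definition mollifier s x y : R :=
  \prod_(k < n) step_kernel N (count_mem k s) (x ord0 k - y ord0 k).

Lemma mollifier_ge0 x y : 0 <= mollifier [::] x y.
Proof. by apply: prodr_ge0 => k _; rewrite step_kernel_ge0// ltW. Qed.

Lemma mollifier_supp s x y k : ~~ (0 <= x ord0 k - y ord0 k <= N^-1) ->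
  mollifier s x y = 0.
Proof.
by move=> h; rewrite /mollifier (bigD1 k)//= step_kernel_supp// mul0r.
Qed.

Lemma mollifier_bounded s : exists2 M, 0 <= M & forall x y,
  `|mollifier s x y| <= M.
Proof.
have /choice[M hM] : forall m, exists M, 0 <= M /\ forall t,
  `|step_kernel N m t| <= M.
  by move=> m; have [M M0 h] := step_kernel_bounded m N0; exists M.
exists (\prod_(k < n) M (count_mem k s)).
  by apply: prodr_ge0 => k _; have [] := hM (count_mem k s).
move=> x y; rewrite /mollifier normr_prod; apply: ler_prod => k _.
by rewrite normr_ge0/=; have [_] := hM (count_mem k s); apply.
Qed.

Lemma mollifier_perm s s' x y : perm_eq s s' ->
  mollifier s x y = mollifier s' x y.
Proof.
by move=> /permP ss; apply: eq_bigr => k _; rewrite ss.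
Qed.

Lemma mollifier_measurable s :
  measurable_fun setT (fun z : 'rV[R]_n * 'rV[R]_n => mollifier s z.1 z.2).
Proof.
apply: (@measurable_prod _ _ _ setT) => k _.
apply: (measurableT_comp (continuous_measurable_fun
  (@step_kernel_continuous _ N _))).
apply: measurable_funB.
  exact: (measurableT_comp (measurable_coord k) measurable_fst).
exact: (measurableT_comp (measurable_coord k) measurable_snd).
Qed.

Lemma mollifier_continuousx s y : continuous (fun x => mollifier s x y).
Proof.
apply: (@pjet_continuous _ _ (fun k m t => step_kernel N m (t - y ord0 k))) =>
  k m t.
exact: step_kernel_sub_derive.
Qed.

(** The mollifier as a function of its second argument: a test function supported
near x. *)
Definition mollifier_at x y := mollifier [::] x y.

Let Brev x k m t := (-1) ^+ m * step_kernel N m (x ord0 k - t) : R.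

Let mollifier_atE x : mollifier_at x = pjet (Brev x) [::].
Proof.
apply/funext => y; rewrite /mollifier_at /mollifier /pjet /prodf;
  apply: eq_bigr => k _.
by rewrite /Brev/= mul1r.
Qed.

Let dBrev x k m (t : R) : is_derive t 1 (Brev x k m) (Brev x k m.+1 t).
Proof. exact: step_kernel_rev_derive. Qed.

Lemma mollifier_at_smooth x : smooth (mollifier_at x).
Proof. by rewrite mollifier_atE; exact: (pjet_smooth (dBrev x)). Qed.

(** Differentiating twice in y instead of x leaves the sign unchanged. *)
Lemma mollifier_at_partial2 x i y :
  partials [:: i; i] (mollifier_at x) y = mollifier [:: i; i] x y.
Proof.
rewrite mollifier_atE (partials_pjet (dBrev x)).
rewrite /pjet /prodf; apply: eq_bigr => k _; rewrite /Brev.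
have -> : (-1) ^+ count_mem k [:: i; i] = 1 :> R; last by rewrite mul1r.
by rewrite /= addn0 addnn -mul2n exprM sqrrN !expr1n.
Qed.

Lemma mollifier_continuousy s x : continuous (mollifier s x).
Proof.
apply: (@prodf_continuous _ _ (fun k t =>
  step_kernel N (count_mem k s) (x ord0 k - t))) => k.
rewrite (_ : (fun t => _) = fun t =>
  step_kernel N (count_mem k s) (-1 * t + x ord0 k)).
  exact: is_derive_continuous
    (is_derive_comp_affine (-1) (x ord0 k) (step_kernel_derive N _)).
by apply/funext => t; rewrite mulN1r addrC.
Qed.

End mollifier.

Lemma prodf_integral {R : realType} n (b : 'I_n -> R -> R) :
  (forall k, continuous (b k)) -> (forall k t, 0 <= b k t) ->
  (forall k, \int[@lebesgue_measure R]_t (b k t)%:E = 1)%E ->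
  (\int[lebesgue_rV n]_x (prodf b x)%:E = 1)%E.
Proof.
elim: n => [|n IH] in b *; move=> cb b0 b1.
  under eq_integral do rewrite /prodf big_ord0.
  by rewrite integral_cst//= diracT mule1.
have prodf_ge0 m (b' : 'I_m -> R -> R) x : (forall k t, 0 <= b' k t) ->
  0 <= prodf b' x.
  by move=> b'0; apply: prodr_ge0 => k _; exact: b'0.
rewrite ge0_integral_cons_rV; last 2 first.
- apply/measurable_EFinP; apply: continuous_measurable_rV.
  exact: prodf_continuous.
- by move=> x; rewrite lee_fin prodf_ge0.
have bE a v : prodf b (cons_rV (a, v)) =
    b ord0 a * prodf (fun k => b (lift ord0 k)) v.
  rewrite /prodf big_ord_recl cons_rV0; congr (_ * _).
  by apply: eq_bigr => k _; rewrite cons_rVS.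
transitivity (\int[@lebesgue_measure R]_a (b ord0 a)%:E)%E; last exact: b1.
apply: eq_integral => a _; under eq_integral do rewrite bE EFinM.
rewrite ge0_integralZl//; first by rewrite IH ?mule1// => k *; auto.
- apply/measurable_EFinP; apply: continuous_measurable_rV.
  exact: prodf_continuous.
- by move=> x _; rewrite lee_fin prodf_ge0.
- by rewrite lee_fin.
Qed.

Section mollifier_mass.
Context {R : realType} {n : nat}.
Variables (N : R) (N0 : 0 < N).

Lemma mollifier_integralx (y : 'rV[R]_n) :
  (\int[lebesgue_rV n]_x (mollifier N [::] x y)%:E = 1)%E.
Proof.
apply: (@prodf_integral _ _ (fun k t => step_kernel N 0 (t - y ord0 k))) =>
  [k|k t|k].
- exact: is_derive_continuous (step_kernel_sub_derive N _ _).
- by rewrite step_kernel_ge0// ltW.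
- exact: step_kernel_integral.
Qed.

Lemma step_kernel_rev_integral (a : R) :
  (\int[@lebesgue_measure R]_t (step_kernel N 0 (a - t))%:E = 1)%E.
Proof.
pose p (t : R) : R := - step (- N * t + N * a).
have p_der (t : R) : is_derive t 1 p (step_kernel N 0 (a - t)).
  have h := is_deriveN (is_derive_comp_affine (- N) (N * a) (step_jet 0) t).
  apply: (is_derive_eq h); have -> : - N * t + N * a = N * (a - t) by ring.
  by rewrite /step_kernel expr1 mulNr opprK.
have ab : a - N^-1 < a by rewrite ltrBlDr ltrDl invr_gt0.
have -> : 1%E = (p a - p (a - N^-1))%:E.
  have e0 : - N * a + N * a = 0 by ring.
  have e1 : - N * (a - N^-1) + N * a = 1 by field; rewrite gt_eqF.
  by rewrite /p e0 e1 step0// step1// oppr0 sub0r opprK.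
apply: (integral_derive_itv ab) p_der _ _.
- rewrite (_ : (fun t => _) = fun t => step_kernel N 0 (-1 * t + a)).
    exact: is_derive_continuous (is_derive_comp_affine (-1) a
      (step_kernel_derive N _)).
  by apply/funext => t; rewrite mulN1r addrC.
- move=> t tab; apply: step_kernel_supp => //;
  apply: contra tab => /andP[h1 h2].
  by rewrite in_itv/=; apply/andP; split; lra.
Qed.

Lemma mollifier_integraly (x : 'rV[R]_n) :
  (\int[lebesgue_rV n]_y (mollifier N [::] x y)%:E = 1)%E.
Proof.
apply: (@prodf_integral _ _ (fun k t => step_kernel N 0 (x ord0 k - t))) =>
  [k|k t|k].
- rewrite (_ : (fun t => _) = fun t => step_kernel N 0 (-1 * t + x ord0 k)).
    exact: is_derive_continuous
      (is_derive_comp_affine (-1) (x ord0 k) (step_kernel_derive N _)).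
  by apply/funext => t; rewrite mulN1r addrC.
- by rewrite step_kernel_ge0// ltW.
- exact: step_kernel_rev_integral.
Qed.

End mollifier_mass.

(** * Mollification and differentiation under the integral *)

Section integrals.
Context d (T : measurableType d) (R : realType).
Variable mu : {measure set T -> \bar R}.

Lemma EFin_Rintegral (f : T -> R) : mu.-integrable setT (EFin \o f) ->
  (\int[mu]_x f x)%:E = (\int[mu]_x (f x)%:E)%E.
Proof. by move=> fi; rewrite /Rintegral fineK//; exact: integrable_fin_num. Qed.

Lemma integrable_scale_abs (M : R) (f : T -> R) :
  mu.-integrable setT (EFin \o f) ->
  mu.-integrable setT (EFin \o (fun x => M * `|f x|)).
Proof.
move=> fi; have := integrableZl measurableT M (integrable_abse fi).
by apply: eq_integrable.
Qed.

Lemma integrable_mul_bounded (f g : T -> R) (M : R) :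
  mu.-integrable setT (EFin \o f) -> measurable_fun setT g ->
  (forall x, `|g x| <= M) -> mu.-integrable setT (EFin \o (fun x => f x * g x)).
Proof.
move=> fi mg gM; apply: le_integrable (integrable_scale_abs M fi) => //.
  apply/measurable_EFinP; apply: measurable_funM => //.
  by apply/measurable_EFinP; case/integrableP: fi.
move=> x _ /=; rewrite lee_fin normrM [leRHS]ger0_norm.
  by rewrite mulrC ler_wpM2r.
by rewrite mulr_ge0// (le_trans _ (gM x)).
Qed.

Lemma Rintegral_cvg (f_ : nat -> T -> R) (f g : T -> R) :
  (forall k, measurable_fun setT (f_ k)) ->
  (forall x, f_ ^~ x @ \oo --> f x) ->
  mu.-integrable setT (EFin \o g) ->
  (forall k x, `|f_ k x| <= g x) ->
  (fun k => \int[mu]_x f_ k x) @ \oo --> (\int[mu]_x f x : R).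
Proof.
move=> mf ff gi fg.
have ff' x : EFin (f_ k x) @[k --> \oo] --> (f x)%:E.
  by apply: cvg_EFin; [exact: nearW|exact: ff].
have [fi _ fc] := @dominated_convergence _ _ _ mu setT measurableT
  (fun k => EFin \o f_ k) (EFin \o f) (EFin \o g)
  (fun k => (measurable_EFinP _ _).2 (mf k))
  ((measurable_EFinP _ _).2 (measurable_fun_cvg mf (fun x _ => ff x)))
  (aeW _ (fun x _ => ff' x)) gi (aeW _ (fun x k _ => fg k x)).
by move: fc; rewrite -(EFin_Rintegral fi) => /fine_cvg.
Qed.

End integrals.

(** Dominated convergence is a statement about sequences, hence this criterion. *)
Lemma continuous_seq_rV {R : realType} n (f : 'rV[R]_n -> R) (x : 'rV[R]_n) :
  (forall u : nat -> 'rV[R]_n, u @ \oo --> x -> (f \o u) @ \oo --> f x) ->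
  {for x, continuous f}.
Proof.
move=> H; apply: contrapT => nf.
have [e e0 He] : exists2 e : R, 0 < e &
    forall d : R, 0 < d -> exists y, ball x d y /\ e <= `|f x - f y|.
  apply: contrapT => h; apply: nf.
  apply/(@cvgrPdist_lt R R^o _ _ (nbhs_filter (x : 'rV[R]_n))) => e e0.
  apply: contrapT => h2; apply: h; exists e => // d d0.
  apply: contrapT => /forallNP h3; apply: h2.
  apply: filterS (@nbhsx_ballx _ _ x d d0) => y xy.
  by rewrite ltNge; apply/negP => h4; apply: (h3 y).
have /choice[u Hu] : forall k : nat, exists y,
    ball x (k.+1%:R^-1) y /\ e <= `|f x - f y|.
  by move=> k; apply: He; rewrite invr_gt0.
have ux : u @ \oo --> x.
  apply/cvg_ballP => d d0; near=> k; have [+ _] := Hu k; apply: le_ball.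
  apply: ltW; near: k; exact: (near_infty_natSinv_lt (PosNum d0)).
have /cvgrPdist_lt/(_ _ e0)[k _ /(_ k (leqnn k))] := H u ux.
by rewrite ltNge/= (Hu k).2.
Unshelve. all: by end_near. Qed.

Section convolution.
Context {R : realType} {n : nat}.
Notation mu := (lebesgue_rV n).
Implicit Types (x y : 'rV[R]_n) (s : seq 'I_n) (w : 'rV[R]_n -> R).
Variables (N : R) (N0 : 0 < N).

Definition mollify w s x : R := \int[mu]_y (w y * mollifier N s x y).

Section fixed_w.
Variable w : 'rV[R]_n -> R.
Hypothesis wi : mu.-integrable setT (EFin \o w).

Lemma measurable_mollifiery s x : measurable_fun setT (mollifier N s x).
Proof. by apply: continuous_measurable_rV; exact: mollifier_continuousy. Qed.

Lemma mollify_integrable s x :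
  mu.-integrable setT (EFin \o (fun y => w y * mollifier N s x y)).
Proof.
have [M M0 hM] := mollifier_bounded N0 s.
by apply: (integrable_mul_bounded wi (measurable_mollifiery s x)).
Qed.

Lemma measurable_w : measurable_fun setT w.
Proof. by apply/measurable_EFinP; case/integrableP: wi. Qed.

Lemma mollify_continuous s : continuous (mollify w s).
Proof.
move=> x; apply: continuous_seq_rV => u ux.
have [M M0 hM] := mollifier_bounded N0 s.
apply: (@Rintegral_cvg _ _ _ mu (fun k y => w y * mollifier N s (u k) y)
  (fun y => w y * mollifier N s x y) (fun y => M * `|w y|)).
- by move=> k; apply: measurable_funM;
  [exact: measurable_w|exact: measurable_mollifiery].
- move=> y; apply: cvgMl_tmp.
  exact: (cvg_comp u (fun x => mollifier N s x y) ux
    (@mollifier_continuousx R n N s y x)).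
- exact: integrable_scale_abs.
- by move=> k y; rewrite normrM mulrC ler_wpM2r.
Qed.

Lemma mollifier_is_derive s i x y :
  is_derive x (delta_mx ord0 i) (fun x => mollifier N s x y)
    (mollifier N (i :: s) x y).
Proof.
pose B := fun k m t => step_kernel N m (t - y ord0 k).
have dB k m (t : R) : is_derive t 1 (B k m)
  (B k m.+1 t) by exact: step_kernel_sub_derive.
have [] := pjet_smooth dB s; rewrite (partials_pjet dB) => _ /(_ x i) h.
apply: DeriveDef => //.
by have /(congr1 (@^~ x)) := pderiv_pjet dB i s.
Qed.

Lemma is_derive_line (G : 'rV[R]_n -> R) (v x : 'rV[R]_n) (h g : R) :
  is_derive (h *: v + x) v G g -> is_derive h 1 (fun t : R => G (t *: v + x)) g.
Proof.
move=> [d1 d2].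
have e : (fun k : R => k^-1 *:
  (((fun t : R => G (t *: v + x)) \o shift h) (k *: 1)
    - G (h *: v + x))) =
  (fun k : R => k^-1 *: ((G \o shift (h *: v + x)) (k *: v) - G (h *: v + x))).
  apply/funext => k /=; have -> : k *: (1 : R^o) = k.
    by rewrite /GRing.scale/= mulr1.
  by rewrite scalerDl addrA.
by apply: DeriveDef; [rewrite /derivable e|rewrite -d2 /derive e].
Qed.

(** The derivative along a coordinate line is that of a function of one variable,
and all the derivatives of the mollifier are bounded. *)
Lemma mollify_is_derive s i x :
  is_derive x (delta_mx ord0 i) (mollify w s) (mollify w (i :: s) x).
Proof.
pose f h y := w y * mollifier N s (h *: delta_mx ord0 i + x) y.
have df (h : R) y : is_derive h 1 (f ^~ y)
  (w y * mollifier N (i :: s) (h *: delta_mx ord0 i + x) y).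
  exact: (is_deriveZ (w y) (is_derive_line (mollifier_is_derive s i _ y))).
have [M M0 hM] := mollifier_bounded N0 (i :: s).
have := @cvg_differentiation_under_integral R _ _ mu f setT measurableT 0 (-1) 1
  _ _ _ (fun y => M * `|w y|) _ _ _.
rewrite /partial1of2.
have -> : \int[mu]_y derive1 (f ^~ y) 0 = mollify w (i :: s) x.
  apply: eq_Rintegral => y _; rewrite derive1E; have := df 0 y => dfy.
  by rewrite derive_val scale0r add0r.
have e : (fun h : R => h^-1 *: ((\int[mu]_y f (h + 0) y) - \int[mu]_y f 0 y)) =
  (fun h : R => h^-1 *: ((mollify w s \o shift x) (h *: delta_mx ord0 i) -
    mollify w s x)).
  by apply/funext => h; rewrite /mollify /f addr0 scale0r add0r.
rewrite e => H.
have {}H : h^-1 *: ((mollify w s \o shift x) (h *: delta_mx ord0 i) -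
  mollify w s x)
   @[h --> 0^'] --> mollify w (i :: s) x.
  apply: H.
  - by rewrite /= in_itv/= ltrN10 ltr01.
  - by move=> h _; exact: mollify_integrable.
  - by move=> h y _ _; case: (df h y).
  - by move=> y; rewrite mulr_ge0.
  - exact: integrable_scale_abs.
  - move=> h y _ _; rewrite derive1E; have := df h y => dfy.
    by rewrite derive_val normrM mulrC ler_wpM2r.
by apply: DeriveDef; [apply/cvg_ex;
  exists (mollify w (i :: s) x)|exact: cvg_lim H].
Qed.

Lemma partials_mollify s : partials s (mollify w [::]) = mollify w s.
Proof.
elim: s => [//|i s IH]; apply/funext => x.
have h := mollify_is_derive s i x.
by rewrite -[LHS]/('D_(delta_mx ord0 i) (partials s (mollify w [::])) x) IH
  derive_val.
Qed.

Lemma mollify_smooth : smooth (mollify w [::]).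
Proof.
move=> s; rewrite partials_mollify; split; first exact: mollify_continuous.
by move=> x i; case: (mollify_is_derive s i x).
Qed.

Lemma mollify_perm s s' : perm_eq s s' -> mollify w s = mollify w s'.
Proof.
move=> ss; apply/funext => x; apply: eq_Rintegral => y _.
by rewrite (mollifier_perm _ _ _ ss).
Qed.

End fixed_w.
End convolution.

(** * Mollification in L^2 and its transpose *)

Section convolution_estimates.
Context {R : realType} {n : nat}.
Notation mu := (lebesgue_rV n).
Implicit Types (x y : 'rV[R]_n) (s : seq 'I_n) (w : 'rV[R]_n -> R).
Variables (N : R) (N0 : 0 < N).

Lemma mollifier_integrabley x :
  mu.-integrable setT (EFin \o mollifier N [::] x).
Proof.
apply/integrableP; split.
  by apply/measurable_EFinP; apply: measurable_mollifiery.
under eq_integral do rewrite /= ger0_norm ?mollifier_ge0//.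
by rewrite mollifier_integraly// ltry.
Qed.

Lemma mollifier_integrablex y :
  mu.-integrable setT (EFin \o (fun x => mollifier N [::] x y)).
Proof.
have mr : measurable_fun setT (fun x => mollifier N [::] x y).
  by apply: continuous_measurable_rV; exact: mollifier_continuousx.
apply/integrableP; split; first exact/measurable_EFinP.
under eq_integral do rewrite /= ger0_norm ?mollifier_ge0//.
by rewrite mollifier_integralx// ltry.
Qed.

Section fixed_w.
Variable w : 'rV[R]_n -> R.
Hypothesis wi : mu.-integrable setT (EFin \o w).

(** Since the mollifier has mass 1 in y, this is the nonnegativity of the variance
int (w - c)^2 with c the mean value of w. *)
Lemma mollify_jensen x : mu.-integrable setT (EFin \o (fun y => w y ^+ 2)) ->
  mollify N w [::] x ^+ 2 <= \int[mu]_y (w y ^+ 2 * mollifier N [::] x y).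
Proof.
move=> w2i; set c := mollify N w [::] x.
have i1 := mollify_integrable N0 w2i [::] x.
have i2 := mollify_integrable N0 wi [::] x.
have i3 := mollifier_integrabley x.
have i2c : mu.-integrable setT
  (EFin \o (fun y => 2 * c * (w y * mollifier N [::] x y))).
  by have := integrableZl measurableT (2 * c) i2; apply: eq_integrable.
have i3c : mu.-integrable setT
  (EFin \o (fun y => c ^+ 2 * mollifier N [::] x y)).
  by have := integrableZl measurableT (c ^+ 2) i3; apply: eq_integrable.
have i12 : mu.-integrable setT (EFin \o (fun y =>
    w y ^+ 2 * mollifier N [::] x y - 2 * c * (w y * mollifier N [::] x y))).
  by have := integrableB measurableT i1 i2c; apply: eq_integrable.
have r1 : \int[mu]_y mollifier N [::] x y =
  1 by rewrite /Rintegral mollifier_integraly.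
have : 0 <= \int[mu]_y ((w y - c) ^+ 2 * mollifier N [::] x y).
  by apply: Rintegral_ge0 => y _; rewrite mulr_ge0 ?sqr_ge0 ?mollifier_ge0.
have -> : \int[mu]_y ((w y - c) ^+ 2 * mollifier N [::] x y) =
    \int[mu]_y (w y ^+ 2 * mollifier N [::] x y -
      2 * c * (w y * mollifier N [::] x y)
       + c ^+ 2 * mollifier N [::] x y).
  by apply: eq_Rintegral => y _; ring.
rewrite RintegralD// RintegralB// RintegralZl// RintegralZl// r1
  -/(mollify N w [::] x) -/c.
by move=> h; rewrite -subr_ge0 (le_trans h)// le_eqVlt; apply/orP; left;
  apply/eqP; ring.
Qed.

(** After [mollify_jensen] the order of integration is exchanged, and the mollifier
also has mass 1 in x. *)
Lemma mollify_L2 : mu.-integrable setT (EFin \o (fun y => w y ^+ 2)) ->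
  (\int[mu]_x ((mollify N w [::] x) ^+ 2)%:E <= \int[mu]_y (w y ^+ 2)%:E)%E.
Proof.
move=> w2i.
have mw := measurable_w wi.
have mw2 : measurable_fun setT (fun y => w y ^+ 2) by exact: measurable_funX.
pose F (z : 'rV[R]_n * 'rV[R]_n) := (w z.2 ^+ 2 * mollifier N [::] z.1 z.2)%:E.
have mF : measurable_fun setT F.
  apply/measurable_EFinP; apply: measurable_funM;
    last exact: mollifier_measurable.
  exact: (measurableT_comp mw2 measurable_snd).
have F0 z : (0 <= F z)%E by rewrite lee_fin mulr_ge0 ?sqr_ge0 ?mollifier_ge0.
apply: (@le_trans _ _ (\int[mu]_x \int[mu]_y F (x, y))%E).
  apply: ge0_le_integral => //.
  - by move=> x _; rewrite lee_fin sqr_ge0.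
  - apply/measurable_EFinP; apply: measurable_funX.
    by apply: continuous_measurable_rV; exact: mollify_continuous.
  - exact: (measurable_fun_fubini_tonelli_F F).
  - move=> x _.
    apply: (@le_trans _ _ (\int[mu]_y (w y ^+ 2 * mollifier N [::] x y))%:E).
      by rewrite lee_fin mollify_jensen.
    by rewrite EFin_Rintegral//; exact: (mollify_integrable N0 w2i).
rewrite (fubini_tonelli F)//; apply: ge0_le_integral => //.
- by move=> y _; apply: integral_ge0 => x _.
- exact: (measurable_fun_fubini_tonelli_G F).
- exact/measurable_EFinP.
move=> y _; rewrite /F/=; under eq_integral do rewrite EFinM.
rewrite ge0_integralZl//; first by rewrite mollifier_integralx// mule1.
- apply/measurable_EFinP; apply: continuous_measurable_rV.
  exact: mollifier_continuousx.
- by move=> x _; rewrite lee_fin mollifier_ge0.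
- by rewrite lee_fin sqr_ge0.
Qed.

Variables (c : 'rV[R]_n) (r : R) (psi : 'rV[R]_n -> R).
Hypotheses (cpsi : continuous psi) (spsi : supp_in c r psi).

(** The transpose of mollification, acting on the test function. *)
Definition mollify_adj y := \int[mu]_x (mollifier N [::] x y * psi x).

(** The measurability statement comes for free from Fubini's theorem. *)
Lemma mollify_pair : measurable_fun setT (fun y => w y * mollify_adj y) /\
  \int[mu]_x (mollify N w [::] x * psi x) = \int[mu]_y (w y * mollify_adj y).
Proof.
have mw := measurable_w wi.
have [M M0 hM] := supp_bounded cpsi spsi.
pose F (z : 'rV[R]_n * 'rV[R]_n) :=
  (w z.2 * mollifier N [::] z.1 z.2 * psi z.1)%:E.
have mF : measurable_fun setT F.
  apply/measurable_EFinP; apply: measurable_funM.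
    apply: measurable_funM; last exact: mollifier_measurable.
    exact: (measurableT_comp mw measurable_snd).
  exact: (measurableT_comp (continuous_measurable_rV cpsi) measurable_fst).
have Fi : (mu \x mu)%E.-integrable setT F.
  apply/integrable21ltyP => //.
  apply: (@le_lt_trans _ _ (\int[mu]_y (M * `|w y|)%:E)%E); last first.
    under eq_integral do rewrite EFinM.
    have /integrableP[_ woo] := wi.
    rewrite ge0_integralZl//; last by apply/measurable_EFinP;
      exact: measurableT_comp.
    by rewrite lte_mul_pinfty.
  apply: ge0_le_integral => //.
  - by move=> y _; exact: integral_ge0.
  - apply: (measurable_fun_fubini_tonelli_G (fun z => `|F z|%E)) => //.
    exact: measurableT_comp.
  - by apply/measurable_EFinP; apply: measurable_funM => //;
    exact: measurableT_comp.
  move=> y _.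
  apply: (@le_trans _ _ (\int[mu]_x
    ((M * `|w y|)%:E * (mollifier N [::] x y)%:E))%E).
    apply: ge0_le_integral => //.
    - by apply: measurableT_comp => //; apply: measurableT_comp mF _;
      exact: measurable_pair2.
    - apply: measurable_funeM; apply/measurable_EFinP.
      by apply: continuous_measurable_rV; exact: mollifier_continuousx.
    - move=> x _; rewrite /F/= -EFinM lee_fin !normrM
      (ger0_norm (mollifier_ge0 _ _ _))//.
      by rewrite mulrC mulrA ler_wpM2r ?mollifier_ge0// ler_wpM2r.
  rewrite ge0_integralZl//; first by rewrite mollifier_integralx// mule1.
  - by apply/measurable_EFinP; apply: continuous_measurable_rV;
    exact: mollifier_continuousx.
  - by move=> x _; rewrite lee_fin mollifier_ge0.
  - by rewrite lee_fin mulr_ge0.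
have E1 : (fun x => \int[mu]_y F (x, y))%E =
  (fun x => (mollify N w [::] x * psi x)%:E).
  apply/funext => x; rewrite /F/= EFinM /mollify EFin_Rintegral;
    last exact: mollify_integrable.
  under eq_integral do rewrite EFinM.
  exact: (integralZr measurableT (mollify_integrable N0 wi [::] x) (psi x)).
have E2 : (fun y => \int[mu]_x F (x, y))%E =
  (fun y => (w y * mollify_adj y)%:E).
  apply/funext => y.
  have ri : mu.-integrable setT (EFin \o
    (fun x => mollifier N [::] x y * psi x)).
    exact: (integrable_mul_bounded (mollifier_integrablex y)
      (continuous_measurable_rV cpsi) hM).
  rewrite EFinM /mollify_adj EFin_Rintegral// -integralZl//.
  by apply: eq_integral => x _; rewrite /F/= -mulrA EFinM.
split.
  by apply/measurable_EFinP; rewrite -[X in measurable_fun _ X]E2;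
    exact: measurable_fubini_G Fi.
have := Fubini Fi; rewrite /= -[X in X = _ ->
  _]/(\int[mu]_x (fun x => \int[mu]_y F (x, y)) x)%E.
rewrite -[X in _ = X -> _]/(\int[mu]_y (fun y => \int[mu]_x F (x, y)) y)%E E1
  E2.
by rewrite /Rintegral => ->.
Qed.

End fixed_w.
End convolution_estimates.

(** * Convergence of mollifications and localisation of the equation *)

Section weak_convergence.
Context {R : realType} {n : nat}.
Notation mu := (lebesgue_rV n).
Implicit Types (x y : 'rV[R]_n).
Variables (c : 'rV[R]_n) (r : R) (psi : 'rV[R]_n -> R).
Hypotheses (cpsi : continuous psi) (spsi : supp_in c r psi).

Lemma mollify_adj_bounded (N M : R) y : 0 < N -> (forall x, `|psi x| <= M) ->
  `|mollify_adj N psi y| <= M.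
Proof.
move=> N0 hM; have mpsi := continuous_measurable_rV cpsi.
have ri := mollifier_integrablex N0 y.
have i1 := integrable_mul_bounded ri mpsi hM.
apply: (le_trans (le_normr_Rintegral measurableT i1)).
have -> : M = \int[mu]_x (mollifier N [::] x y * M).
  by rewrite RintegralZr// /Rintegral mollifier_integralx// mul1r.
apply: le_Rintegral => //.
- by have := integrable_abse i1; apply: eq_integrable.
- by have := integrableZr measurableT M ri; apply: eq_integrable.
- by move=> x _; rewrite normrM ger0_norm ?mollifier_ge0// ler_wpM2l
  ?mollifier_ge0.
Qed.

Lemma mollify_adj_near (N e : R) y : 0 < N ->
  (forall x, (forall i, `|x ord0 i - y ord0 i| <= N^-1) ->
    `|psi x - psi y| <= e) ->
  `|mollify_adj N psi y - psi y| <= e.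
Proof.
move=> N0 he; have mpsi := continuous_measurable_rV cpsi.
have [M M0 hM] := supp_bounded cpsi spsi.
have ri := mollifier_integrablex N0 y.
have i1 := integrable_mul_bounded ri mpsi hM.
have i2 : mu.-integrable setT (EFin \o (fun x => mollifier N [::] x y * psi y)).
  by have := integrableZr measurableT (psi y) ri; apply: eq_integrable.
have e1 z : \int[mu]_x (mollifier N [::] x y * z) = z.
  by rewrite RintegralZr// /Rintegral mollifier_integralx// mul1r.
rewrite /mollify_adj -[X in _ - X]e1 -RintegralB//.
have i3 : mu.-integrable setT (EFin \o
  (fun x => mollifier N [::] x y * psi x - mollifier N [::] x y * psi y)).
  by have := integrableB measurableT i1 i2; apply: eq_integrable.
apply: (le_trans (le_normr_Rintegral measurableT i3)).
rewrite -[leRHS](e1 e); apply: le_Rintegral => //.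
- by have := integrable_abse i3; apply: eq_integrable.
- by have := integrableZr measurableT e ri; apply: eq_integrable.
move=> x _; rewrite -mulrBr normrM ger0_norm ?mollifier_ge0//.
have [xy|nxy] := pselect (forall i, 0 <= x ord0 i - y ord0 i <= N^-1).
  rewrite ler_wpM2l ?mollifier_ge0//; apply: he => i.
  by have /andP[h0 h1] := xy i; rewrite ger0_norm.
have /existsNP[i /negP nxyi] := nxy.
by rewrite (mollifier_supp N0 _ nxyi) !mul0r.
Qed.

Lemma mollify_adj_cvg y : (fun k : nat => mollify_adj k.+1%:R psi y) @ \oo -->
  psi y.
Proof.
apply/cvgrPdist_le => e e0.
have cy : {for y, continuous psi} by exact: cpsi.
move: cy => /(@cvgrPdist_le R R^o _ _ (nbhs_filter (y : 'rV[R]_n)))/(_ e e0).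
move=> /nbhs_ballP[d /= d0 hd]; near=> k.
rewrite distrC; apply: mollify_adj_near => // x xy; rewrite distrC; apply: hd.
split=> // i j; rewrite (ord1 i) /ball/= distrC (le_lt_trans (xy j))//.
by near: k; exact: (near_infty_natSinv_lt (PosNum d0)).
Unshelve. all: by end_near. Qed.

(** The limit is taken on the test function side, where pointwise convergence is
just continuity. *)
Lemma mollify_weak_cvg (w : 'rV[R]_n -> R) : mu.-integrable setT (EFin \o w) ->
  (fun k : nat => \int[mu]_x (mollify k.+1%:R w [::] x * psi x)) @ \oo -->
  (\int[mu]_y (w y * psi y) : R).
Proof.
move=> wi; have [M M0 hM] := supp_bounded cpsi spsi.
rewrite (_ : (fun k : nat => _) = fun k :
  nat => \int[mu]_y (w y * mollify_adj k.+1%:R psi y)).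
  apply: (@Rintegral_cvg _ _ _ mu (fun k y => w y * mollify_adj k.+1%:R psi y)
    (fun y => w y * psi y) (fun y => M * `|w y|)).
  - by move=> k; have [] := mollify_pair (ltr0Sn R k) wi cpsi spsi.
  - by move=> y; apply: cvgMl_tmp; exact: mollify_adj_cvg.
  - exact: integrable_scale_abs.
  - by move=> k y; rewrite normrM mulrC ler_wpM2r// mollify_adj_bounded.
by apply/funext => k; have [] := mollify_pair (ltr0Sn R k) wi cpsi spsi.
Qed.

End weak_convergence.

Section restriction.
Context {R : realType} {n : nat}.
Notation mu := (lebesgue_rV n).
Implicit Types (Omega : set 'rV[R]_n) (u phi : 'rV[R]_n -> R).

Lemma supp_test_function Omega c r phi : smooth phi -> supp_in c r phi ->
  box c r `<=` Omega -> test_function Omega phi.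
Proof.
move=> sphi cphi bO.
have clb : closed_support phi `<=` box c r.
  apply: (subset_trans (closureS _) (@box_closed _ _ c r)) => x /= /eqP px.
  by apply: contrapT => /cphi.
split => //; last exact: subset_trans clb bO.
apply: (subclosed_compact _ (@box_compact _ _ c r)) => //.
exact: closed_closure.
Qed.

Definition restrict_box c r u : 'rV[R]_n -> R := u \_ (box c r).

Lemma restrict_boxE Omega c r' u (S : set 'rV[R]_n) (psi : 'rV[R]_n -> R) :
  box c r' `<=` Omega -> (forall x, ~ S x -> psi x = 0) -> S `<=` box c r' ->
  \int[mu]_(x in Omega) (u x * psi x) =
    \int[mu]_x (restrict_box c r' u x * psi x).
Proof.
move=> bO psi0 rr'; rewrite Rintegral_mkcond; apply: eq_Rintegral => x _.
rewrite /restrict_box !patchE; have [bx|nbx] := pselect (S x).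
  by rewrite !mem_set//; [exact: rr'|exact/bO/rr'].
by rewrite (psi0 _ nbx) !mulr0; case: ifP.
Qed.

Lemma restrict_box_measurable Omega c r u : open Omega -> L2loc Omega u ->
  box c r `<=` Omega -> measurable_fun setT (restrict_box c r u).
Proof.
move=> oO [mu_ _] bO; apply/(measurable_restrictT _ (@box_measurable _ _ c r)).
by apply: (measurable_funS _ bO mu_); exact: open_measurable_rV.
Qed.

Lemma restrict_box_sq_integrable Omega c r u : open Omega -> L2loc Omega u ->
  box c r `<=` Omega -> mu.-integrable setT
    (EFin \o (fun x => restrict_box c r u x ^+ 2)).
Proof.
move=> oO uL bO; have mr := restrict_box_measurable oO uL bO.
have [_ /(_ _ (@box_compact _ _ c r) bO) uoo] := uL.
apply/integrableP; split; first by apply/measurable_EFinP;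
  exact: measurable_funX.
move: uoo; rewrite integral_mkcond; congr (_ < _)%E; apply: eq_integral => x _.
rewrite /restrict_box /= !patchE; case: ifPn => _;
  last by rewrite expr0n/= normr0.
by rewrite real_normK ?num_real// ger0_norm// sqr_ge0.
Qed.

(** A cube has finite measure and |u| <= u^2 + 1. *)
Lemma restrict_box_integrable Omega c r u : open Omega -> L2loc Omega u ->
  box c r `<=` Omega -> mu.-integrable setT (EFin \o restrict_box c r u).
Proof.
move=> oO uL bO; have mr := restrict_box_measurable oO uL bO.
have i2 := restrict_box_sq_integrable oO uL bO.
have i1 : mu.-integrable setT (EFin \o \1_(box c r)).
  apply/integrableP; split.
    by apply/measurable_EFinP; apply: measurable_indic; exact: box_measurable.
  rewrite (eq_integral (fun x => (\1_(box c r) x)%:E)); last first.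
    by move=> x _; rewrite /= ger0_norm// indicE.
  rewrite integral_indic ?setIT//; [exact: box_finite|exact: box_measurable].
have i12 := integrableD measurableT i2 i1.
apply: le_integrable i12 => //; first exact/measurable_EFinP.
move=> x _ /=; rewrite lee_fin /restrict_box patchE indicE.
case: ifPn => xb; last by rewrite normr0.
rewrite [leRHS]ger0_norm ?addr_ge0 ?sqr_ge0//.
have -> : u x ^+ 2 = `|u x| ^+ 2 by rewrite real_normK ?num_real.
have : 0 <= (`|u x| - 1) ^+ 2 by rewrite sqr_ge0.
have := normr_ge0 (u x); move: `|u x| => a a0.
by rewrite /=; nra.
Qed.

(** The equation for u is tested against the mollifier centred at x, whose support
lies in the cube of radius r' and hence in Omega. *)
Lemma laplacian_mollify Omega (N r r' : R) (c x : 'rV[R]_n) u f : open Omega ->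
  L2loc Omega u -> L2loc Omega f -> 0 < N -> box c r' `<=` Omega ->
  (forall phi : 'rV[R]_n -> R, test_function Omega phi ->
      \int[mu]_(x in Omega) (u x * laplacian phi x) =
      \int[mu]_(x in Omega) (f x * phi x)) ->
  box c r x -> r + N^-1 <= r' ->
  laplacian (mollify N (restrict_box c r' u) [::]) x =
    mollify N (restrict_box c r' f) [::] x.
Proof.
move=> oO uL fL N0 bO huf bx rr'.
have wi := restrict_box_integrable oO uL bO.
have bsub : box x N^-1 `<=` box c r'.
  move=> y /boxP xy; apply/boxP => i; move/boxP : bx => /(_ i) xc.
  rewrite (le_trans _ rr')// (_ :
    _ - _ = (x ord0 i - c ord0 i) + (y ord0 i - x ord0 i)); last by ring.
  by rewrite (le_trans (ler_normD _ _))// lerD.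
have rho0 s y : ~ box x N^-1 y -> mollifier N s x y = 0.
  move=> nb; have [i hi] : exists i, ~~ (0 <= x ord0 i - y ord0 i <= N^-1).
    apply: contrapT => /forallNP h; apply: nb; apply/boxP => i.
    have /negP := h i; rewrite negbK => /andP[h0 h1].
    by rewrite distrC ger0_norm.
  exact: (mollifier_supp N0 s hi).
have lapE y : laplacian (mollifier_at N x) y =
  \sum_(i < n) mollifier N [:: i; i] x y.
  by apply: eq_bigr => i _; rewrite mollifier_at_partial2.
have tphi : test_function Omega (mollifier_at N x).
  apply: (@supp_test_function _ x N^-1); first exact: mollifier_at_smooth.
    by move=> y /rho0; exact.
  exact: subset_trans bsub bO.
have := huf _ tphi.
rewrite (restrict_boxE u bO _ bsub); last first.
  by move=> y nb; rewrite lapE big1// => i _; exact: rho0.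
rewrite (restrict_boxE f bO _ bsub); last by move=> y /rho0; exact.
rewrite -/(mollify N (restrict_box c r' f) [::] x) => <-.
have -> : laplacian (mollify N (restrict_box c r' u) [::]) x =
    \sum_(i < n) mollify N (restrict_box c r' u) [:: i; i] x.
  by apply: eq_bigr => i _; rewrite (partials_mollify N0 wi).
under eq_Rintegral do rewrite -/(laplacian _ _) lapE mulr_sumr.
rewrite /mollify.
suff : forall l : seq 'I_n,
    mu.-integrable setT (EFin \o (fun y =>
      \sum_(i <- l) restrict_box c r' u y * mollifier N [:: i; i] x y)) /\
    \sum_(i <- l) \int[mu]_y (restrict_box c r' u y * mollifier N [:: i; i] x
      y) =
    \int[mu]_y \sum_(i <- l) restrict_box c r' u y * mollifier N [:: i; i] x y.
  by move=> /(_ (index_enum 'I_n))[].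
elim=> [|i l [IHi IH]].
  split; last by under [RHS]eq_Rintegral do rewrite big_nil;
    rewrite big_nil Rintegral_cst// mul0r.
  rewrite (_ : EFin \o _ = cst 0%E); first exact: integrable0.
  by apply/funext => y /=; rewrite big_nil.
have ii := mollify_integrable N0 wi [:: i; i] x.
split.
  have := integrableD measurableT ii IHi; apply: eq_integrable => // y _.
  by rewrite /= big_cons EFinD.
under [RHS]eq_Rintegral do rewrite big_cons.
by rewrite big_cons IH RintegralD.
Qed.

End restriction.

(** * Energy estimates for smooth functions *)

Section energy.
Context {R : realType} {n : nat}.
Notation mu := (lebesgue_rV n).
Implicit Types (f g chi : 'rV[R]_n -> R) (c x : 'rV[R]_n).

Lemma supp_inW c r r' f : r <= r' -> supp_in c r f -> supp_in c r' f.
Proof.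
move=> rr' sf x nb; apply: sf => /boxP bx; apply: nb; apply/boxP => i.
exact: le_trans (bx i) rr'.
Qed.

Lemma supp_inD c r f g : supp_in c r f -> supp_in c r g ->
  supp_in c r (fun x => f x + g x).
Proof. by move=> sf sg x nb; rewrite sf// sg// addr0. Qed.

(** The cutoff is 1 on the support of f.  This is how the derivatives of one cutoff
are absorbed by the next, wider one. *)
Lemma cutoff_dominates c r f : 0 < r -> continuous f -> supp_in c r f ->
  exists2 C, 0 <= C & forall x, `|f x| <= C * cutoff c r x.
Proof.
move=> r0 cf sf; have [C C0 hC] := supp_bounded cf sf; exists C => // x.
have [bx|nb] := pselect (box c r x); first by rewrite cutoff1// mulr1.
by rewrite sf// normr0 mulr_ge0// cutoff_ge0.
Qed.

Lemma smooth_laplacian f : smooth f -> smooth (laplacian f).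
Proof.
move=> sf; apply: smooth_sum => i.
exact: (@smooth_partials _ _ [:: i; i]).
Qed.

Lemma laplacianE f x : laplacian f x = \sum_(i < n) pderiv i (pderiv i f) x.
Proof. by []. Qed.

Lemma Rintegral_sum0 (F : 'I_n -> 'rV[R]_n -> R) c r :
  (forall i, smooth (F i)) -> (forall i, supp_in c r (F i)) ->
  (forall i, \int[mu]_x F i x = 0) -> \int[mu]_x (\sum_(i < n) F i x) = 0.
Proof.
move=> sF cF F0.
suff : forall l : seq 'I_n, \int[mu]_x (\sum_(i <- l) F i x) = 0 by apply.
elim=> [|i l IH].
  by under eq_Rintegral do rewrite big_nil; rewrite Rintegral_cst// mul0r.
under eq_Rintegral do rewrite big_cons.
rewrite RintegralD// ?F0 ?IH ?addr0//; first exact: smooth_integrable (cF i).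
apply: (@smooth_integrable _ _ _ c r); first exact: smooth_sum.
by move=> x nb; rewrite big1// => j _; exact: cF.
Qed.

Definition grad2 f x : R := \sum_(i < n) pderiv i f x ^+ 2.

(** The integrand is the sum over i of the derivatives
d_i (chi f d_i f - f^2 d_i chi / 2). *)
Lemma energy_identity c r f chi : smooth f -> smooth chi -> supp_in c r chi ->
  \int[mu]_x (chi x * grad2 f x + chi x * f x * laplacian f x
              - 2^-1 * f x ^+ 2 * laplacian chi x) = 0.
Proof.
move=> sf schi cchi.
pose F i x := chi x * f x * pderiv i f x + -
  2^-1 * (f x * f x * pderiv i chi x).
have sdf i := smooth_pderiv i sf; have sdc i := smooth_pderiv i schi.
have s1 := smoothM schi sf; have s2 := smoothM sf sf.
have sF i : smooth (F i).
  exact: (smoothD (smoothM s1 (sdf i)) (smoothZ (- 2^-1) (smoothM s2 (sdc i)))).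
have cF i : supp_in c r (F i).
  move=> x nb; rewrite /F cchi// (supp_pderiv i cchi nb); ring.
have E i x : pderiv i (F i) x = chi x * pderiv i f x ^+ 2 +
  chi x * f x * pderiv i (pderiv i f) x
    - 2^-1 * f x ^+ 2 * pderiv i (pderiv i chi) x.
  have eD := smooth_pderivD i (smoothM s1 (sdf i))
    (smoothZ (- 2^-1) (smoothM s2 (sdc i))).
  have e1 := smooth_pderivM i s1 (sdf i).
  have e2 := smooth_pderivM i schi sf.
  have e3 := smooth_pderivM i (smooth_cst (- 2^-1 : R)) (smoothM s2 (sdc i)).
  have e4 := smooth_pderivM i s2 (sdc i).
  have e5 := smooth_pderivM i sf sf.
  rewrite eD e1 e2 e3 e4 e5 pderiv_cst.
  move: (chi x) (f x) (pderiv i f x) (pderiv i (pderiv i f) x) (pderiv i chi x)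
    (pderiv i (pderiv i chi) x) => a b b1 b2 a1 a2.
  by field.
clearbody F.
rewrite -[RHS](Rintegral_sum0 (fun i => smooth_pderiv i (sF i))
  (fun i => supp_pderiv i (cF i)) (fun i => Rintegral_pderiv0 i (sF i) (cF i))).
apply: eq_Rintegral => x _; rewrite (eq_bigr _ (fun i _ => E i x)).
rewrite /grad2 !laplacianE.
rewrite 3!mulr_sumr.
rewrite -big_split.
rewrite -sumrB.
reflexivity.
Qed.

Lemma smooth_sq f : smooth f -> smooth (fun x => f x ^+ 2).
Proof. by move=> sf; have := smoothM sf sf. Qed.

Lemma smooth_grad2 f : smooth f -> smooth (grad2 f).
Proof.
move=> sf; have h i : smooth (fun x => pderiv i f x ^+ 2) by
  exact/smooth_sq/smooth_pderiv.
exact: (smooth_sum _ h).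
Qed.

Lemma grad2_ge0 f x : 0 <= grad2 f x.
Proof. by apply: sumr_ge0 => i _; exact: sqr_ge0. Qed.

Lemma sq_le_grad2 i f x : pderiv i f x ^+ 2 <= grad2 f x.
Proof.
rewrite /grad2 (bigD1 i)//= lerDl; apply: sumr_ge0 => j _; exact: sqr_ge0.
Qed.

Lemma le_Rintegral_smooth c r f g : smooth f -> supp_in c r f ->
  smooth g -> supp_in c r g -> (forall x, f x <= g x) ->
  \int[mu]_x f x <= \int[mu]_x g x.
Proof.
move=> sf cf sg cg fg; apply: le_Rintegral => //.
- exact: smooth_integrable cf.
- exact: smooth_integrable cg.
Qed.

Section two_cutoffs.
Variables (c : 'rV[R]_n) (r C : R) (f chi chi0 : 'rV[R]_n -> R).
Hypotheses (sf : smooth f) (schi : smooth chi) (schi0 : smooth chi0).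
Hypotheses (cchi : supp_in c r chi) (cchi0 : supp_in c r chi0).
Hypotheses (chi_ge0 : forall x, 0 <= chi x).
Hypotheses (chi_le : forall x, chi x <= C * chi0 x).
Hypotheses (lchi_le : forall x, `|laplacian chi x| <= C * chi0 x).

(** In [energy_identity] the two terms other than chi |grad f|^2 contain no
derivative of f besides its Laplacian, so Young's inequality bounds them at
once. *)
Lemma energy_gradient : \int[mu]_x (chi x * grad2 f x) <=
  \int[mu]_x (C * (chi0 x * (f x ^+ 2 + laplacian f x ^+ 2))).
Proof.
pose P x := chi x * grad2 f x + chi x * f x * laplacian f x
              - 2^-1 * f x ^+ 2 * laplacian chi x.
have P0 : \int[mu]_x P x = 0 := energy_identity sf schi cchi.
have slf := smooth_laplacian sf; have slc := smooth_laplacian schi.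
have sP : smooth P.
  exact: (smoothB (smoothD (smoothM schi (smooth_grad2 sf))
    (smoothM (smoothM schi sf) slf))
      (smoothM (smoothZ 2^-1 (smooth_sq sf)) slc)).
have clc : supp_in c r (laplacian chi).
  move=> x nb; rewrite laplacianE big1// => i _.
  exact: (supp_pderiv i (supp_pderiv i cchi)).
have cP : supp_in c r P.
  move=> x nb; rewrite /P cchi// clc//; ring.
pose Q x := C * (chi0 x * (f x ^+ 2 + laplacian f x ^+ 2)).
have sQ : smooth Q.
  exact: (smoothZ C (smoothM schi0 (smoothD (smooth_sq sf) (smooth_sq slf)))).
have cQ : supp_in c r Q by move=> x nb; rewrite /Q cchi0// mul0r mulr0.
have PQ x : chi x * grad2 f x <= P x + Q x.
  rewrite /P /Q; move: (grad2 f x) => G.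
  have := chi_ge0 x; have := chi_le x; have := lchi_le x.
  rewrite ler_norml mulrA => /andP[_ +].
  move: (chi x) (C * chi0 x) (laplacian chi x) (laplacian f x) (f x) =>
    a t l h u.
  move=> lt at_ a0.
  have h1 : 0 <= a * (u + h) ^+ 2 by rewrite mulr_ge0// sqr_ge0.
  have h2 : 0 <= (t - a) * (u ^+ 2 + h ^+ 2).
    by rewrite mulr_ge0 ?subr_ge0// addr_ge0// sqr_ge0.
  have h3 : 0 <= (t - l) * u ^+ 2 by rewrite mulr_ge0 ?subr_ge0// sqr_ge0.
  have h4 : 0 <= t * h ^+ 2 by rewrite mulr_ge0 ?sqr_ge0// (le_trans a0).
  lra.
rewrite -/Q -[leRHS]add0r -P0; clearbody P Q.
rewrite -(RintegralD measurableT (smooth_integrable sP cP)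
  (smooth_integrable sQ cQ)).
apply: (@le_Rintegral_smooth c r _ _ (smoothM schi (smooth_grad2 sf)) _
  (smoothD sP sQ) (supp_inD cP cQ) PQ).
by move=> x nb; rewrite cchi// mul0r.
Qed.

(** [energy_identity] for g = d_i f contains chi g d_i h with h the Laplacian of f.
Subtracting the divergence d_i (chi g h) leaves only h itself; half of the term
chi h d_i g is absorbed by the left-hand side, whence the factor 2. *)
Lemma energy_hessian i : (forall x, `|pderiv i chi x| <= C * chi0 x) ->
  laplacian (pderiv i f) = pderiv i (laplacian f) ->
  \int[mu]_x (chi x * grad2 (pderiv i f) x) <=
  \int[mu]_x (2 * C * (chi0 x * (pderiv i f x ^+ 2 + laplacian f x ^+ 2))).
Proof.
move=> dchi_le comm; pose g := pderiv i f; pose h := laplacian f.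
have sg : smooth g := smooth_pderiv i sf.
have sh : smooth h := smooth_laplacian sf.
have slc := smooth_laplacian schi.
pose P x := chi x * grad2 g x + chi x * g x * laplacian g x
              - 2^-1 * g x ^+ 2 * laplacian chi x.
have P0 : \int[mu]_x P x = 0 := energy_identity sg schi cchi.
have schg := smoothM schi sg.
have sP : smooth P.
  exact: (smoothB (smoothD (smoothM schi (smooth_grad2 sg))
    (smoothM schg (smooth_laplacian sg)))
      (smoothM (smoothZ 2^-1 (smooth_sq sg)) slc)).
have clc : supp_in c r (laplacian chi).
  move=> x nb; rewrite laplacianE big1// => j _.
  exact: (supp_pderiv j (supp_pderiv j cchi)).
have cP : supp_in c r P.
  move=> x nb; rewrite /P cchi// clc//; ring.
pose Q := pderiv i (fun x => chi x * g x * h x).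
have sQ : smooth Q := smooth_pderiv i (smoothM schg sh).
have cgh : supp_in c r (fun x => chi x * g x * h x).
  by move=> x nb; rewrite cchi// !mul0r.
have cQ : supp_in c r Q := supp_pderiv i cgh.
have Q0 : \int[mu]_x Q x = 0 := Rintegral_pderiv0 i (smoothM schg sh) cgh.
have QE x : Q x = chi x * g x * laplacian g x
    + (chi x * pderiv i g x + pderiv i chi x * g x) * h x.
  by rewrite /Q (smooth_pderivM i schg sh) (smooth_pderivM i schi sg) comm.
pose S x := 2 * C * (chi0 x * (g x ^+ 2 + h x ^+ 2)).
have sS : smooth S.
  exact: (smoothZ (2 * C) (smoothM schi0
    (smoothD (smooth_sq sg) (smooth_sq sh)))).
have cS : supp_in c r S by move=> x nb; rewrite /S cchi0// mul0r mulr0.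
have PQ x : chi x * grad2 g x <= 2 * (P x - Q x) + S x.
  rewrite QE /P /S.
  have := chi_ge0 x; have := chi_le x; have := lchi_le x; have := dchi_le x.
  have := sq_le_grad2 i g x.
  rewrite -/h -/g 2!ler_norml -[2 * C * _]mulrA [C * (_ * _)]mulrA.
  move: (chi x) (C * chi0 x) (laplacian chi x) (laplacian g x) (h x) (g x)
    (grad2 g x)
    (pderiv i g x) (pderiv i chi x) => a t l q k u G d e.
  move=> dG /andP[et te] /andP[_ lt] at_ a0.
  have h1 : 0 <= a * (d - k) ^+ 2 by rewrite mulr_ge0// sqr_ge0.
  have h2 : 0 <= (t - a) * k ^+ 2 by rewrite mulr_ge0 ?subr_ge0// sqr_ge0.
  have h3 : 0 <= (t - l) * u ^+ 2 by rewrite mulr_ge0 ?subr_ge0// sqr_ge0.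
  have h4 : 0 <= (t - e) * (u + k) ^+ 2 by rewrite mulr_ge0 ?subr_ge0// sqr_ge0.
  have h5 : 0 <= (t + e) * (u - k) ^+ 2.
    by rewrite mulr_ge0 ?sqr_ge0// addrC -[t]opprK subr_ge0.
  have h6 : 0 <= a * (G - d ^+ 2) by rewrite mulr_ge0// subr_ge0.
  lra.
rewrite -[leRHS]/(\int[mu]_x S x) -/g.
have s2 : smooth (fun x => 2 * (P x - Q x)) := smoothZ 2 (smoothB sP sQ).
have c2 : supp_in c r (fun x => 2 * (P x - Q x)).
  by move=> x nb; rewrite cP// cQ// subrr mulr0.
have i0 : \int[mu]_x (2 * (P x - Q x)) = 0.
  have iP := smooth_integrable sP cP; have iQ := smooth_integrable sQ cQ.
  have iPQ : mu.-integrable setT (EFin \o (fun x => P x - Q x)).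
    by have := integrableB measurableT iP iQ; apply: eq_integrable.
  by rewrite RintegralZl// RintegralB// P0 Q0 subrr mulr0.
rewrite -[leRHS]add0r -i0; clearbody P Q S.
rewrite -(RintegralD measurableT (smooth_integrable s2 c2)
  (smooth_integrable sS cS)).
apply: (@le_Rintegral_smooth c r _ _ (smoothM schi (smooth_grad2 sg)) _
  (smoothD s2 sS) (supp_inD c2 cS) PQ).
by move=> x nb; rewrite cchi// mul0r.
Qed.

End two_cutoffs.

End energy.

(** * Uniform bounds for the mollified solution *)

Section local_bound.
Context {R : realType} {n : nat}.
Notation mu := (lebesgue_rV n).
Variables (Omega : set 'rV[R]_n) (u f : 'rV[R]_n -> R).
Hypotheses (oO : open Omega) (uL : L2loc Omega u) (fL : L2loc Omega f).
Hypothesis huf : forall phi : 'rV[R]_n -> R, test_function Omega phi ->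
      \int[mu]_(x in Omega) (u x * laplacian phi x) =
      \int[mu]_(x in Omega) (f x * phi x).
Variables (c : 'rV[R]_n) (r : R).
Hypotheses (r0 : 0 < r) (bO : box c (9 * r) `<=` Omega).

Let w := restrict_box c (9 * r) u.
Let F := restrict_box c (9 * r) f.
Let v N := mollify N w [::].
(* Nested cutoffs: each one equals 1 on the support of the next. *)
Let chi0 := cutoff c (2 * (2 * r)).
Let chi1 := cutoff c (2 * r).
Let chi2 := cutoff c r.
Let wi : mu.-integrable setT (EFin \o w) := restrict_box_integrable oO uL bO.
Let Fi : mu.-integrable setT (EFin \o F) := restrict_box_integrable oO fL bO.

Let r2 : 0 < 2 * r. Proof. by rewrite mulr_gt0. Qed.
Let r4 : 0 < 2 * (2 * r). Proof. by rewrite mulr_gt0. Qed.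

Let s0 : smooth chi0 := cutoff_smooth _ _.
Let s1 : smooth chi1 := cutoff_smooth _ _.
Let s2 : smooth chi2 := cutoff_smooth _ _.
Let c0 : supp_in c (2 * (2 * (2 * r))) chi0 := cutoff_supp r4.
Let c1 : supp_in c (2 * (2 * r)) chi1 := cutoff_supp r2.
Let c2 : supp_in c (2 * r) chi2 := cutoff_supp r0.

Let sv N : 0 < N -> smooth (v N). Proof. by move=> N0;
  exact: (mollify_smooth N0 wi). Qed.

Let A := \int[mu]_x (w x ^+ 2) + \int[mu]_x (F x ^+ 2).

Let bound0 N : 0 < N -> N^-1 <= r ->
  \int[mu]_x (chi0 x * (v N x ^+ 2 + laplacian (v N) x ^+ 2)) <= A.
Proof.
move=> N0 Nr.
have w2i : mu.-integrable setT (EFin \o (fun x => w x ^+ 2)) :=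
  restrict_box_sq_integrable oO uL bO.
have F2i : mu.-integrable setT (EFin \o (fun x => F x ^+ 2)) :=
  restrict_box_sq_integrable oO fL bO.
have svN := sv N0; have slv := smooth_laplacian svN.
have sint : smooth (fun x => chi0 x * (v N x ^+ 2 + laplacian (v N) x ^+ 2)).
  exact: (smoothM s0 (smoothD (smooth_sq svN) (smooth_sq slv))).
have cint : supp_in c (2 * (2 * (2 * r)))
    (fun x => chi0 x * (v N x ^+ 2 + laplacian (v N) x ^+ 2)).
  by move=> x nb; rewrite c0// mul0r.
have sF : smooth (mollify N F [::]) := mollify_smooth N0 Fi.
have m1 : measurable_fun setT (fun x => ((v N x) ^+ 2)%:E).
  apply/measurable_EFinP; apply: continuous_measurable_rV.
  exact: smooth_continuous (smooth_sq svN).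
have m2 : measurable_fun setT (fun x => ((mollify N F [::] x) ^+ 2)%:E).
  apply/measurable_EFinP; apply: continuous_measurable_rV.
  exact: smooth_continuous (smooth_sq sF).
rewrite -lee_fin (EFin_Rintegral (smooth_integrable sint cint)) EFinD.
rewrite (EFin_Rintegral w2i) (EFin_Rintegral F2i).
apply: (@le_trans _ _ (\int[mu]_x
  (((v N x) ^+ 2)%:E + ((mollify N F [::] x) ^+ 2)%:E))%E).
  apply: ge0_le_integral => //.
  - by move=> x _; rewrite lee_fin mulr_ge0 ?cutoff_ge0// addr_ge0// sqr_ge0.
  - apply/measurable_EFinP; apply: continuous_measurable_rV.
    exact: smooth_continuous sint.
  - exact: emeasurable_funD.
  move=> x _; rewrite -EFinD lee_fin.
  have [bx|nb] := pselect (box c (2 * (2 * (2 * r))) x); last first.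
    by rewrite c0// mul0r addr_ge0// sqr_ge0.
  have -> : laplacian (v N) x = mollify N F [::] x.
    by apply: (laplacian_mollify oO uL fL N0 bO huf bx); lra.
  by rewrite ler_piMl ?cutoff_le1 ?addr_ge0 ?sqr_ge0.
have q1 : forall y, [set: 'rV[R]_n] y -> (0 <= ((v N y) ^+ 2)%:E)%E.
  by move=> y _; rewrite lee_fin sqr_ge0.
have q2 : forall y, [set: 'rV[R]_n] y ->
  (0 <= ((mollify N F [::] y) ^+ 2)%:E)%E.
  by move=> y _; rewrite lee_fin sqr_ge0.
rewrite (ge0_integralD mu measurableT q1 m1 q2 m2).
exact: leeD (mollify_L2 N0 wi w2i) (mollify_L2 N0 Fi F2i).
Qed.

(** Both sides are mollifications of index a permutation of [:: i; j; j]. *)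
Let comm N i : 0 < N -> laplacian (pderiv i (v N)) = pderiv i (laplacian (v N)).
Proof.
move=> N0; apply/funext => x.
have E := smooth_partials_sum [:: i] (index_enum 'I_n)
  (fun j => smooth_partials [:: j; j] (sv N0)).
rewrite -[RHS]/(partials [:: i]
  (fun x => \sum_(j < n) partials [:: j; j] (v N) x) x) E.
apply: eq_bigr => j _.
rewrite -[LHS]/(partials [:: j; j; i] (v N) x)
  -[RHS]/(partials [:: i; j; j] (v N) x).
rewrite (partials_mollify N0 wi [:: j; j; i])
  (partials_mollify N0 wi [:: i; j; j]).
have jji : perm_eq [:: j; j; i] [:: i; j; j] by rewrite (perm_catC [:: j; j]).
by rewrite (mollify_perm N w jji).
Qed.

(** One constant C makes each cutoff dominate the narrower one together with its
first derivatives and its Laplacian; the two energy estimates are then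
chained, starting from the bound on v and its Laplacian. *)
Lemma uniform_bound : exists B, forall N, 0 < N -> N^-1 <= r -> forall i,
  \int[mu]_x (chi2 x * pderiv i (v N) x ^+ 2) <= B /\
  \int[mu]_x (chi2 x * grad2 (pderiv i (v N)) x) <= B.
Proof.
have smc (g : 'rV[R]_n -> R) : smooth g -> continuous g :=
  @smooth_continuous _ _ g.
have cl (g : 'rV[R]_n -> R) r' : supp_in c r' g -> supp_in c r' (laplacian g).
  move=> cg x nb; rewrite laplacianE big1// => j _.
  exact: (supp_pderiv j (supp_pderiv j cg)).
have [C1 C10 hC1] := cutoff_dominates r4 (smc _ (smooth_laplacian s1))
  (cl _ _ c1).
have [C2 C20 hC2] := cutoff_dominates r2 (smc _ (smooth_laplacian s2))
  (cl _ _ c2).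
have [C3 C30 hC3] := cutoff_dominates r4 (smc _ s1) c1.
have [C4 C40 hC4] := cutoff_dominates r2 (smc _ s2) c2.
have /choice[C5 hC5] : forall i, exists C, 0 <= C /\
    forall x, `|pderiv i chi2 x| <= C * chi1 x.
  move=> i; have [C C0 hC] := cutoff_dominates r2 (smc _ (smooth_pderiv i s2))
    (supp_pderiv i c2).
  by exists C.
pose C := C1 + C2 + C3 + C4 + \sum_i C5 i.
have C5_ge0 : 0 <= \sum_i C5 i by apply: sumr_ge0 => i _; have [] := hC5 i.
have C_ge0 : 0 <= C by rewrite !addr_ge0.
have mono a b x y : a <= b -> 0 <= y -> x <= a * y -> x <= b * y :> R.
  by move=> ab y0 /le_trans; apply; rewrite ler_wpM2r.
have h1 x : `|laplacian chi1 x| <= C * chi0 x.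
  by apply: mono (hC1 x); rewrite ?cutoff_ge0// /C; lra.
have h2 x : `|laplacian chi2 x| <= C * chi1 x.
  by apply: mono (hC2 x); rewrite ?cutoff_ge0// /C; lra.
have h3 x : chi1 x <= C * chi0 x.
  apply: (le_trans (ler_norm _)).
  by apply: mono (hC3 x); rewrite ?cutoff_ge0// /C; lra.
have h4 x : chi2 x <= C * chi1 x.
  apply: (le_trans (ler_norm _)).
  by apply: mono (hC4 x); rewrite ?cutoff_ge0// /C; lra.
have h5 i x : `|pderiv i chi2 x| <= C * chi1 x.
  have [_ /(_ x)] := hC5 i; apply: mono; rewrite ?cutoff_ge0//.
  have : C5 i <= \sum_i C5 i.
    by rewrite (bigD1 i)//= lerDl; apply: sumr_ge0 => j _; have [] := hC5 j.
  by rewrite /C; lra.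
have A0 : 0 <= A.
  by rewrite addr_ge0//; apply: Rintegral_ge0 => x _; rewrite sqr_ge0.
exists (C * (C * A) + 2 * C * (C * A + C * A)) => N N0 Nr i.
have b0 := bound0 N0 Nr; have svN := sv N0; have slv := smooth_laplacian svN.
set V := v N in b0 svN slv *.
pose I0 x := chi0 x * (V x ^+ 2 + laplacian V x ^+ 2).
have sI0 : smooth I0 := smoothM s0 (smoothD (smooth_sq svN) (smooth_sq slv)).
have cI0 : supp_in c (2 * (2 * (2 * r))) I0.
  by move=> x nb; rewrite /I0 c0// mul0r.
have iI0 := smooth_integrable sI0 cI0.
have chi1_ge0 x : 0 <= chi1 x := cutoff_ge0 _ _ _.
have chi2_ge0 x : 0 <= chi2 x := cutoff_ge0 _ _ _.
have chi0_ge0 x : 0 <= chi0 x := cutoff_ge0 _ _ _.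
have rr1 : 2 * (2 * r) <= 2 * (2 * (2 * r)) by move: r0 => ?; lra.
have rr2 : 2 * r <= 2 * (2 * r) by move: r0 => ?; lra.
have e1 := energy_gradient svN s1 s0 (supp_inW rr1 c1) c0 chi1_ge0 h3 h1.
have e2 := energy_hessian svN s2 s1 (supp_inW rr2 c2) c1 chi2_ge0 h4 h2 (h5 i)
  (comm i N0).
have b1 : \int[mu]_x (chi1 x * grad2 V x) <= C * A.
  apply: (le_trans e1); rewrite -[leLHS]/(\int[mu]_x (C * I0 x)) RintegralZl//.
  by rewrite ler_wpM2l.
have sg1 : smooth (fun x => chi1 x * grad2 V x) :=
  smoothM s1 (smooth_grad2 svN).
have cg1 : supp_in c (2 * (2 * r)) (fun x => chi1 x * grad2 V x).
  by move=> x nb; rewrite c1// mul0r.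
have sl1 : smooth (fun x => chi1 x * laplacian V x ^+ 2) :=
  smoothM s1 (smooth_sq slv).
have cl1 : supp_in c (2 * (2 * r)) (fun x => chi1 x * laplacian V x ^+ 2).
  by move=> x nb; rewrite c1// mul0r.
have b2 : \int[mu]_x (chi1 x * laplacian V x ^+ 2) <= C * A.
  apply: (@le_trans _ _ (\int[mu]_x (C * I0 x))).
    apply: (le_Rintegral_smooth sl1 (supp_inW rr1 cl1) (smoothZ C sI0)).
      by move=> x nb; rewrite cI0// mulr0.
    move=> x; rewrite /I0 mulrA; apply:
      (@le_trans _ _ (C * chi0 x * laplacian V x ^+ 2)).
      by rewrite ler_wpM2r ?sqr_ge0.
    by rewrite ler_wpM2l ?mulr_ge0// lerDr sqr_ge0.
  by rewrite RintegralZl// ler_wpM2l.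
have sS := smoothD sg1 sl1; have cS := supp_inD cg1 cl1.
have iS := smooth_integrable sS cS.
have bS : \int[mu]_x (chi1 x * grad2 V x + chi1 x * laplacian V x ^+ 2) <=
  C * A + C * A.
  rewrite (RintegralD measurableT (smooth_integrable sg1 cg1)
    (smooth_integrable sl1 cl1)).
  exact: lerD.
have CA : 0 <= C * (C * A) by rewrite !mulr_ge0.
have CA2 : 0 <= 2 * C * (C * A + C * A) by rewrite !mulr_ge0// addr_ge0//
  mulr_ge0.
split.
  apply: (@le_trans _ _ (C * (C * A))); last by rewrite lerDl.
  apply: (@le_trans _ _ (\int[mu]_x (C * (chi1 x * grad2 V x)))).
    apply: (@le_Rintegral_smooth R n c (2 * (2 * r)) _ _
      (smoothM s2 (smooth_sq (smooth_pderiv i svN))) _ (smoothZ C sg1)).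
    - by move=> x nb; rewrite (supp_inW rr2 c2)// mul0r.
    - by move=> x nb; rewrite cg1// mulr0.
    move=> x; rewrite mulrA; apply: (@le_trans _ _ (chi2 x * grad2 V x)).
      by rewrite ler_wpM2l// sq_le_grad2.
    by rewrite ler_wpM2r// grad2_ge0.
  rewrite (RintegralZl _ measurableT (smooth_integrable sg1 cg1)).
  by rewrite ler_wpM2l.
apply: (@le_trans _ _ (2 * C * (C * A + C * A))); last by rewrite lerDr.
apply: (le_trans e2).
apply: (@le_trans _ _ (\int[mu]_x
  (2 * C * (chi1 x * grad2 V x + chi1 x * laplacian V x ^+ 2)))).
  have sq1 : smooth (fun x => 2 * C *
    (chi1 x * (pderiv i V x ^+ 2 + laplacian V x ^+ 2))).
    exact: (smoothZ (2 * C) (smoothM s1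
      (smoothD (smooth_sq (smooth_pderiv i svN)) (smooth_sq slv)))).
  apply: (@le_Rintegral_smooth R n c (2 * (2 * r)) _ _ sq1 _
    (smoothZ (2 * C) sS)).
  - by move=> x nb; rewrite c1// mul0r mulr0.
  - by move=> x nb; rewrite cS// mulr0.
  move=> x; rewrite -mulrDr ler_wpM2l ?mulr_ge0// ler_wpM2l//.
  by rewrite lerD2r sq_le_grad2.
rewrite (RintegralZl _ measurableT iS) ler_wpM2l// mulr_ge0//.
Qed.

(** The derivatives are moved onto the mollified solution, where |a b| <= a^2 + b^2 / 4
and [uniform_bound] apply, and the width of the mollifier then tends to 0. *)
Lemma functional_bound : exists B, forall s : seq 'I_n, (0 < size s <= 2)%N ->
  forall phi : 'rV[R]_n -> R, smooth phi -> supp_in c r phi ->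
  `|\int[mu]_(x in Omega) (u x * partials s phi x)| <=
    B + 4^-1 * \int[mu]_x (phi x ^+ 2).
Proof.
have [B hB] := uniform_bound; exists B => s s2' phi sphi cphi.
have rr9 : r <= 9 * r by move: r0 => ?; lra.
have rr2 : r <= 2 * r by move: r0 => ?; lra.
have bsub : box c r `<=` box c (9 * r).
  by move=> x /boxP bx; apply/boxP => i; exact: le_trans (bx i) rr9.
rewrite (restrict_boxE u bO (supp_partials s cphi) bsub) -/w.
have H := mollify_weak_cvg (smooth_continuous (smooth_partials s sphi))
  (supp_partials s cphi) wi.
have /cvg_norm nH := H.
apply: (cvgr_to_le nH); near=> k.
have N0 : 0 < k.+1%:R :> R by [].
have Nr : k.+1%:R^-1 <= r.
  by apply: ltW; near: k; exact: (near_infty_natSinv_lt (PosNum r0)).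
have hk := hB _ N0 Nr; have svk := sv N0.
rewrite (integral_partials_rV s svk sphi cphi) normrM normrX normrN1 expr1n
  mul1r.
set D := partials (rev s) (v k.+1%:R).
have sD : smooth D := smooth_partials (rev s) svk.
have sDphi := smoothM sD sphi.
have cDphi : supp_in c r (fun x => D x * phi x) := supp_inMr D cphi.
have iDphi := smooth_integrable sDphi cDphi.
have sR : smooth (fun x => chi2 x * D x ^+ 2) := smoothM s2 (smooth_sq sD).
have cR : supp_in c (2 * r) (fun x => chi2 x * D x ^+ 2).
  by move=> x nb; rewrite c2// mul0r.
have sP : smooth (fun x => 4^-1 * phi x ^+ 2) := smoothZ 4^-1 (smooth_sq sphi).
have cP2 : supp_in c r (fun x => phi x ^+ 2).
  by move=> x nb; rewrite cphi// expr0n.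
have cP : supp_in c r (fun x => 4^-1 * phi x ^+ 2).
  by move=> x nb; rewrite cphi// expr0n mulr0.
apply: (le_trans (le_normr_Rintegral measurableT iDphi)).
apply: (@le_trans _ _ (\int[mu]_x (chi2 x * D x ^+ 2 + 4^-1 * phi x ^+ 2))).
  apply: le_Rintegral => //.
  - by have := integrable_abse iDphi; apply: eq_integrable.
  - exact: smooth_integrable (smoothD sR sP) (supp_inD cR (supp_inW rr2 cP)).
  move=> x _; have [bx|nb] := pselect (box c r x); last first.
    by rewrite cphi// mulr0 normr0 addr_ge0// mulr_ge0 ?cutoff_ge0 ?sqr_ge0.
  rewrite /chi2 cutoff1// mul1r ler_norml.
  have h1 : 0 <= (D x - 2^-1 * phi x) ^+ 2 by rewrite sqr_ge0.
  have h2 : 0 <= (D x + 2^-1 * phi x) ^+ 2 by rewrite sqr_ge0.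
  by apply/andP; split; lra.
rewrite (RintegralD measurableT (smooth_integrable sR cR)
  (smooth_integrable sP cP)).
rewrite (RintegralZl _ measurableT (smooth_integrable (smooth_sq sphi) cP2))
  lerD2r.
case: s s2' @D sD sDphi cDphi iDphi sR cR {H nH} =>
  [//|i [|j [|//]]] _ D sD sDphi cDphi iDphi sR cR.
  by have [] := hk i.
have [_] := hk i; apply: le_trans.
apply: (le_Rintegral_smooth sR cR
  (smoothM s2 (smooth_grad2 (smooth_pderiv i svk)))).
  by move=> x nb; rewrite c2// mul0r.
move=> x; rewrite ler_wpM2l ?cutoff_ge0//.
exact: (sq_le_grad2 j (pderiv i (v k.+1%:R)) x).
Unshelve. all: by end_near. Qed.

End local_bound.

(** * Representation of quadratically bounded functionals *)

(** The weighted sum S of the 2^k (phi_(k+1) - phi_k)^2 is integrable, hence finite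
almost everywhere, and |a| <= 2^-k + 2^k a^2 shows that phi_k converges wherever
S is finite.  Setting the functions to 0 where S is infinite makes the
convergence hold everywhere, dominated by |phi_0| + 2 + S. *)
Section fast_cauchy.
Context d (T : measurableType d) (R : realType).
Variable mu : {measure set T -> \bar R}.
Variables (phi : nat -> T -> R) (C B : R).
Hypothesis mphi : forall k, measurable_fun setT (phi k).
Hypothesis phi_cauchy : forall k,
  (\int[mu]_x ((phi k.+1 x - phi k x) ^+ 2)%:E <= (C * 4^-1 ^+ k)%:E)%E.
Hypothesis phi_bound : forall k, (\int[mu]_x (phi k x ^+ 2)%:E <= B%:E)%E.

Let a k x := phi k.+1 x - phi k x.
Let t k x := (2 ^+ k * a k x ^+ 2)%:E.
Let S x := (\sum_(k <oo) t k x)%E.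

Let ma k : measurable_fun setT (a k).
Proof. exact: measurable_funB. Qed.

Let mt k : measurable_fun setT (t k).
Proof.
by apply/measurable_EFinP; apply: measurable_funM => //; exact: measurable_funX.
Qed.

Let t0 k x : (0 <= t k x)%E.
Proof. by rewrite lee_fin mulr_ge0 ?sqr_ge0 ?exprn_ge0. Qed.

Let S0 x : (0 <= S x)%E.
Proof. by apply: nneseries_ge0 => k _ _; exact: t0. Qed.

Let mS : measurable_fun setT S.
Proof.
by apply: (@ge0_emeasurable_sum _ _ _ setT t xpredT) => // k x _ _; exact: t0.
Qed.

Let intS : (\int[mu]_x S x < +oo)%E.
Proof.
rewrite /S integral_nneseries//.
apply: (@le_lt_trans _ _ (\sum_(k <oo) (2 * C / (2 ^ (k + 1))%:R)%:E)%E).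
  apply: lee_nneseries => k _; first by move=> _; apply: integral_ge0 => x _;
    exact: t0.
  rewrite /t; under eq_integral do rewrite EFinM.
  have ma2 : measurable_fun setT (fun x => (a k x ^+ 2)%:E).
    by apply/measurable_EFinP; exact: measurable_funX.
  have a2 x : [set: T] x -> (0 <= (a k x ^+ 2)%:E)%E.
    by move=> _; rewrite lee_fin sqr_ge0.
  rewrite (ge0_integralZl mu measurableT ma2 a2); last first.
    by rewrite lee_fin exprn_ge0.
  apply: (@le_trans _ _ ((2 ^+ k)%:E * (C * 4^-1 ^+ k)%:E)%E).
    by apply: lee_wpmul2l; [rewrite lee_fin exprn_ge0|exact: phi_cauchy].
  rewrite -EFinM lee_fin natrX exprD expr1 le_eqVlt; apply/orP; left; apply/eqP.
  have -> : 4^-1 = 2^-1 * 2^-1 :> R by field.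
  by rewrite exprMn exprVn; field; rewrite expf_neq0.
have e := cvg_lim (@ereal_hausdorff R)
  (@cvg_geometric_eseries_half R (2 * C) 0).
rewrite -[X in (X < _)%E]/(limn
  (eseries (fun k : nat => (2 * C / (2 ^ (k + 1))%:R)%:E))).
by rewrite e ltry.
Qed.

Let D := [set x | S x \is a fin_num].

Let mD : measurable D.
Proof. by have := emeasurable_fin_num measurableT mS; rewrite setTI. Qed.

Let Si : mu.-integrable setT S.
Proof.
apply/integrableP; split => //; under eq_integral do rewrite gee0_abs//.
exact: intS.
Qed.

Let aeD : {ae mu, forall x, D x}.
Proof. by have := integrable_ae measurableT Si; apply: filterS => x; exact. Qed.

Let geom_le (k : nat) : \sum_(0 <= j < k) (2^-1 ^+ j : R) <= 2.
Proof.
suff -> : \sum_(0 <= j < k) (2^-1 ^+ j : R) = 2 - 2 * 2^-1 ^+ k.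
  by rewrite lerBlDr lerDl mulr_ge0// exprn_ge0// invr_ge0.
elim: k => [|k IH]; first by rewrite big_geq// expr0; ring.
by rewrite big_nat_recr//= IH exprS; field.
Qed.

Let sum_abs_le x k : D x ->
  \sum_(0 <= j < k) `|a j x| <= 2 + fine (S x).
Proof.
move=> Dx; apply: (@le_trans _ _
  (\sum_(0 <= j < k) (2^-1 ^+ j + 2 ^+ j * a j x ^+ 2))).
  apply: ler_sum => j _.
  have p0 : 0 < 2 ^+ j :> R by rewrite exprn_gt0.
  rewrite exprVn; move: (2 ^+ j) p0 => p p0.
  have h : 0 <= p^-1 * (p * `|a j x| - 1) ^+ 2 by rewrite mulr_ge0 ?sqr_ge0//
    invr_ge0 ltW.
  have e : p^-1 * (p * `|a j x| - 1) ^+ 2 = p^-1 + p * a j x ^+ 2 -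
    2 * `|a j x|.
    rewrite -[a j x ^+ 2]real_normK ?num_real//; field; by rewrite gt_eqF.
  have := normr_ge0 (a j x); lra.
rewrite big_split /= lerD// -lee_fin fineK//.
have -> : ((\sum_(0 <= j < k) 2 ^+ j * a j x ^+ 2)%:E =
  \sum_(0 <= j < k) t j x)%E.
  by rewrite sumEFin.
by apply: nneseries_lim_ge => j _ _; exact: t0.
Qed.

Let phi_le x k : D x -> `|phi k x| <= `|phi 0%N x| + 2 + fine (S x).
Proof.
move=> Dx; have -> : phi k x = phi 0%N x + \sum_(0 <= j < k) a j x.
  by rewrite telescope_sumr// addrC subrK.
rewrite (le_trans (ler_normD _ _))// -addrA lerD2l.
rewrite (le_trans (ler_norm_sum _ _ _))//; exact: sum_abs_le.
Qed.

Let phi_cvg x : D x -> cvgn (phi ^~ x).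
Proof.
move=> Dx; have : cvgn [normed series (a ^~ x)].
  apply: nondecreasing_is_cvgn.
    by apply: nondecreasing_series => j _ _; exact: normr_ge0.
  exists (2 + fine (S x)) => _ [k _ <-]; exact: sum_abs_le.
move=> /normed_cvg sc.
rewrite (_ : phi ^~ x = fun k => phi 0%N x + series (a ^~ x) k).
  by apply: is_cvgD => //; exact: is_cvg_cst.
by apply/funext => k; rewrite /series/= telescope_sumr// addrC subrK.
Qed.

Let psi k := phi k \_ D.
Let G x := limn (psi ^~ x).

Let psi_cvg x : psi ^~ x @ \oo --> G x.
Proof.
rewrite /G /psi; have [Dx|nDx] := pselect (D x).
  rewrite (_ : (fun k => (phi k \_ D) x) = phi ^~ x); first exact: phi_cvg.
  by apply/funext => k; rewrite patchE mem_set.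
rewrite (_ : (fun k => (phi k \_ D) x) = fun=> 0); first exact: is_cvg_cst.
by apply/funext => k; rewrite patchE memNset.
Qed.

Let mpsi k : measurable_fun setT (psi k).
Proof. by apply/(measurable_restrictT _ mD); exact: measurable_funTS. Qed.

Lemma fast_cauchy_L2_limit : exists G : T -> R, [/\ measurable_fun setT G,
  (\int[mu]_x (G x ^+ 2)%:E <= B%:E)%E &
  forall (g : T -> R) (M : R), mu.-integrable setT (EFin \o g) ->
    (forall x, `|g x| <= M) ->
    (fun k => \int[mu]_x (phi k x * g x)) @ \oo -->
      (\int[mu]_x (G x * g x) : R)].
Proof.
exists G; split.
- exact: (measurable_fun_cvg mpsi (fun x _ => @psi_cvg x)).
- have -> : (\int[mu]_x (G x ^+ 2)%:E =
      \int[mu]_x limn_einf (fun k => (psi k x ^+ 2)%:E))%E.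
    apply: eq_integral => x _; apply/esym.
    have h : (psi k x ^+ 2)%:E @[k --> \oo] --> (G x ^+ 2)%:E.
      apply: cvg_EFin; first exact: nearW.
      exact: (cvgM (@psi_cvg x) (@psi_cvg x)).
    have /cvg_limn_einf_sup[] := h; done.
  apply: (le_trans (fatou _ _ _ _)) => //.
  + by move=> k; apply/measurable_EFinP; exact: measurable_funX.
  + by move=> k x _; rewrite lee_fin sqr_ge0.
  rewrite limn_einf_lim; apply: lime_le; first exact: is_cvg_einfs.
  apply: nearW => k; apply: (@le_trans _ _ (\int[mu]_x (psi k x ^+ 2)%:E)%E).
    by apply: ereal_inf_lbound; exists k => /=.
  apply: le_trans (phi_bound k); apply: ge0_le_integral => //.
  + by move=> x _; rewrite lee_fin sqr_ge0.
  + by apply/measurable_EFinP; exact: measurable_funX.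
  + by apply/measurable_EFinP; exact: measurable_funX.
  move=> x _; rewrite lee_fin /psi patchE; case: ifP => // _.
  by rewrite expr0n sqr_ge0.
move=> g M gi gM; have mg : measurable_fun setT g.
  by apply/measurable_EFinP; case/integrableP: gi.
have -> : (fun k => \int[mu]_x (phi k x * g x)) =
  (fun k => \int[mu]_x (psi k x * g x)).
  apply/funext => k; rewrite /Rintegral; congr fine.
  apply: ae_eq_integral => //.
  - by apply/measurable_EFinP; exact: measurable_funM.
  - by apply/measurable_EFinP; exact: measurable_funM.
  by apply: filterS aeD => x Dx _; rewrite /psi patchE mem_set.
apply: (@Rintegral_cvg _ _ _ mu (fun k x => psi k x * g x) _
  (fun x => 3 * `|g x| + (M * phi 0%N x ^+ 2 + M * fine (S x)))).
- by move=> k; exact: measurable_funM.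
- by move=> x; apply: cvgMr_tmp; exact: psi_cvg.
- have p2 : mu.-integrable setT (EFin \o (fun x => phi 0%N x ^+ 2)).
    apply/integrableP; split; first by apply/measurable_EFinP;
      exact: measurable_funX.
    under eq_integral do rewrite /= ger0_norm ?sqr_ge0//.
    exact: le_lt_trans (phi_bound 0%N) (ltry _).
  have fS : mu.-integrable setT (EFin \o (fun x => fine (S x))).
    apply: le_integrable Si => //.
      by apply/measurable_EFinP; exact: measurableT_comp.
    move=> x _; rewrite /= ger0_norm ?fine_ge0// gee0_abs//.
    by case: (S x) (S0 x) => [r| |]//=; rewrite leey.
  have := integrableD measurableT
    (integrableZl measurableT 3 (integrable_abse gi))
    (integrableD measurableT (integrableZl measurableT M p2)
      (integrableZl measurableT M fS)).
  by apply: eq_integrable.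
- move=> k x; rewrite /psi patchE.
  have g0 := normr_ge0 (g x); have M0 := le_trans g0 (gM x).
  have f0 : 0 <= fine (S x) by rewrite fine_ge0.
  have p0 := sqr_ge0 (phi 0%N x).
  have M1 : 0 <= M * phi 0%N x ^+ 2 by rewrite mulr_ge0.
  have M2 : 0 <= M * fine (S x) by rewrite mulr_ge0.
  case: ifPn => [/set_mem Dx|_]; last by rewrite mul0r normr0; lra.
  have h1 : 0 <= (M - `|g x|) * phi 0%N x ^+ 2 by rewrite mulr_ge0// subr_ge0.
  have h2 : 0 <= (M - `|g x|) * fine (S x) by rewrite mulr_ge0// subr_ge0.
  have h3 : `|phi 0%N x| <= 1 + phi 0%N x ^+ 2.
    rewrite -[phi 0%N x ^+ 2]real_normK ?num_real//.
    have : 0 <= (`|phi 0%N x| - 1) ^+ 2 by rewrite sqr_ge0.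
    have := normr_ge0 (phi 0%N x); move: `|phi 0%N x| => b b0; nra.
  have h4 : `|phi k x| * `|g x| <= (`|phi 0%N x| + 2 + fine (S x)) * `|g x|.
    by rewrite ler_wpM2r// phi_le.
  have h5 : `|phi 0%N x| * `|g x| <= (1 + phi 0%N x ^+ 2) * `|g x|.
    by rewrite ler_wpM2r.
  by rewrite normrM; lra.
Qed.

End fast_cauchy.

(** With N the square of the L^2 norm and J f = N f / 2 - l f, the hypothesis
bounds J from below.  By the parallelogram identity a minimising sequence is
Cauchy, and comparing J at phi_k and at phi_k + t psi shows that l psi is the
limit of the scalar products with phi_k. *)
Section riesz.
Context {R : realType} {n : nat}.
Notation mu := (lebesgue_rV n).
Variables (c : 'rV[R]_n) (r B : R) (l : ('rV[R]_n -> R) -> R).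

Definition test_in (phi : 'rV[R]_n -> R) := smooth phi /\ supp_in c r phi.

Hypothesis lD : forall f g, test_in f -> test_in g ->
  l (fun x => f x + g x) = l f + l g.
Hypothesis lZ : forall (a : R) f, test_in f -> l (fun x => a * f x) = a * l f.
Hypothesis lB : forall f, test_in f ->
  `|l f| <= B + 4^-1 * \int[mu]_x (f x ^+ 2).

Let N (f : 'rV[R]_n -> R) : R := \int[mu]_x (f x ^+ 2).
Let ip (f g : 'rV[R]_n -> R) : R := \int[mu]_x (f x * g x).
Let J (f : 'rV[R]_n -> R) : R := 2^-1 * N f - l f.

Let testD f g : test_in f -> test_in g -> test_in (fun x => f x + g x).
Proof.
by move=> [sf cf] [sg cg]; split;
  [exact: smoothD|move=> x nb; rewrite cf// cg// addr0].
Qed.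

Let testZ a f : test_in f -> test_in (fun x => a * f x).
Proof.
by move=> [sf cf]; split; [exact: smoothZ|move=> x nb; rewrite cf// mulr0].
Qed.

Let ipi f g : test_in f -> test_in g ->
  mu.-integrable setT (EFin \o (fun x => f x * g x)).
Proof.
move=> [sf cf] [sg cg]; apply:
  (smooth_integrable (smoothM sf sg) (c := c) (r := r)).
by move=> x nb; rewrite cf// mul0r.
Qed.

Let Ni f : test_in f -> mu.-integrable setT (EFin \o (fun x => f x ^+ 2)).
Proof. by move=> tf; exact: (ipi tf tf). Qed.

Let NZD a f g : test_in f -> test_in g ->
  N (fun x => f x + a * g x) = N f + 2 * a * ip f g + a ^+ 2 * N g.
Proof.
move=> tf tg.
have i1 := Ni tf; have i2 := ipi tf tg; have i3 := Ni tg.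
have i2a : mu.-integrable setT (EFin \o (fun x => 2 * a * (f x * g x))).
  by have := integrableZl measurableT (2 * a) i2; apply: eq_integrable.
have i3a : mu.-integrable setT (EFin \o (fun x => a ^+ 2 * g x ^+ 2)).
  by have := integrableZl measurableT (a ^+ 2) i3; apply: eq_integrable.
have i12 : mu.-integrable setT
  (EFin \o (fun x => f x ^+ 2 + 2 * a * (f x * g x))).
  by have := integrableD measurableT i1 i2a; apply: eq_integrable.
transitivity (\int[mu]_x (f x ^+ 2 + 2 * a * (f x * g x) + a ^+ 2 * g x ^+ 2)).
  by apply: eq_Rintegral => x _; ring.
by rewrite !(RintegralD, RintegralZl)// .
Qed.

Let J_ge f : test_in f -> - B + 4^-1 * N f <= J f.
Proof.
move=> tf; have := lB tf; rewrite ler_norml -/(N f) /J => /andP[_].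
by move: (N f) (l f) => a b; lra.
Qed.

Let JZD a f g : test_in f -> test_in g ->
  J (fun x => f x + a * g x) = J f + a * (ip f g - l g) + 2^-1 * a ^+ 2 * N g.
Proof.
move=> tf tg; rewrite /J NZD// lD//; last exact: testZ.
by rewrite lZ//; field.
Qed.

Let N_ge0 f : 0 <= N f.
Proof. by apply: Rintegral_ge0 => x _; rewrite sqr_ge0. Qed.

Lemma riesz_test_functions : exists G : 'rV[R]_n ->
  R, [/\ measurable_fun setT G,
  (\int[mu]_x (G x ^+ 2)%:E < +oo)%E &
  forall phi, test_in phi -> l phi = \int[mu]_x (G x * phi x)].
Proof.
pose E := [set J f | f in test_in].
have lbE : lbound E (- B).
  by move=> _ [f tf <-]; apply: le_trans (J_ge tf); rewrite lerDl mulr_ge0.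
have hE : has_inf E.
  split; last by exists (- B).
  exists (J (fun=> 0)), (fun=> 0) => //; split; [exact: smooth_cst|by []].
set m := inf E.
have mJ f : test_in f -> m <= J f.
  by move=> tf; apply: ge_inf; [exists (- B)|exists f].
have /choice[phi hphi] : forall k :
  nat, exists f, test_in f /\ J f < m + 4^-1 ^+ k.
  move=> k; have [|_ [f tf <-] hf] := @inf_adherent _ E (4^-1 ^+ k) _ hE.
    by rewrite exprn_gt0// invr_gt0.
  by exists f.
have tphi k : test_in (phi k) by have [] := hphi k.
have Jphi k : J (phi k) < m + 4^-1 ^+ k by have [] := hphi k.
have q0 k : 0 < 4^-1 ^+ k :> R by rewrite exprn_gt0// invr_gt0.
have q1 k : 4^-1 ^+ k <= 1 :> R by rewrite exprn_ile1 ?invr_ge0// invf_le1//;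
  lra.
have cauchy k : N (fun x => phi k.+1 x - phi k x) <= 8 * 4^-1 ^+ k.
  set g := fun x => _.
  have tg : test_in g.
    have := testD (tphi k.+1) (testZ (-1) (tphi k)).
    by under eq_fun do rewrite mulN1r.
  have e1 := JZD 1 (tphi k) tg; have e2 := JZD 2^-1 (tphi k) tg.
  have e3 := mJ _ (testD (tphi k) (testZ 2^-1 tg)).
  have e4 : (fun x => phi k x + 1 * g x) = phi k.+1.
    by apply/funext => x; rewrite /g mul1r addrC subrK.
  rewrite e4 in e1; rewrite e2 in e3.
  have := Jphi k; have := Jphi k.+1; have := q0 k; rewrite exprS.
  move: e1 e3; move: (J _) (J _) (ip _ _) (l _) (N _) (4^-1 ^+ k) =>
    j1 j2 p q x y.
  lra.
have bound k : N (phi k) <= 4 * (m + 1 + B).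
  have := J_ge (tphi k); have := Jphi k; have := q1 k.
  by move: (N _) (J _) => x y; lra.
have mphi k : measurable_fun setT (phi k).
  by apply: continuous_measurable_rV; apply: smooth_continuous; have [] :=
    tphi k.
have [k|k|G [mG G2 HG]] := @fast_cauchy_L2_limit _ _ R mu phi 8
  (4 * (m + 1 + B)) mphi.
- have td : test_in (fun x => phi k.+1 x - phi k x).
    have := testD (tphi k.+1) (testZ (-1) (tphi k)).
    by under eq_fun do rewrite mulN1r.
  by rewrite -(EFin_Rintegral (Ni td)) lee_fin; exact: cauchy.
- by rewrite -(EFin_Rintegral (Ni (tphi k))) lee_fin; exact: bound.
exists G; split=> //; first exact: le_lt_trans G2 (ltry _).
move=> psi tpsi; have [spsi cpsi] := tpsi.
have [M M0 psiM] := supp_bounded (smooth_continuous spsi) cpsi.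
have H1 := HG psi M (smooth_integrable spsi cpsi) psiM.
suff H2 : (fun k => ip (phi k) psi) @ \oo --> l psi.
  exact: (cvg_unique _ H2 H1).
(* The choice t = 2^-k, up to sign, balances the error 4^-k made in minimising. *)
have near_l k : `|l psi - ip (phi k) psi| <= (1 + N psi) * 2^-1 ^+ k.
  have h0 : 0 < 2^-1 ^+ k :> R by rewrite exprn_gt0// invr_gt0.
  have e0 : 4^-1 ^+ k = 2^-1 ^+ k * 2^-1 ^+ k :> R.
    by rewrite -exprMn; congr (_ ^+ _); field.
  have e1 := mJ _ (testD (tphi k) (testZ (2^-1 ^+ k) tpsi)).
  have e2 := mJ _ (testD (tphi k) (testZ (- 2^-1 ^+ k) tpsi)).
  rewrite JZD// in e1; rewrite JZD// in e2.
  have := Jphi k; rewrite e0; have N0 := N_ge0 psi.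
  move: e1 e2 h0 N0 {e0}; rewrite sqrrN expr2.
  move: (2^-1 ^+ k) (J _) (ip _ _) (l _) (N _) => h j p q y e1 e2 h0 y0 e3.
  rewrite -(ler_pM2l h0) -[X in X * `|_|](gtr0_norm h0) -normrM ler_norml.
  have h2 : 0 <= h * h * y by rewrite mulr_ge0// mulr_ge0// ltW.
  by apply/andP; split; lra.
apply/cvgrPdist_le => e e0.
have /cvgrPdist_le/(_ e e0) : geometric (1 + N psi) (2^-1 : R) @ \oo -->
  (0 : R).
  by apply: cvg_geometric; rewrite ger0_norm ?invr_ge0//; lra.
apply: filterS => k; rewrite sub0r normrN; apply: le_trans.
by rewrite (le_trans (near_l k))// ler_norm.
Qed.

End riesz.

(** * Local weak derivatives and their gluing *)

Section gluing.
Context {R : realType} {n : nat}.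
Notation mu := (lebesgue_rV n).
Variables (Omega : set 'rV[R]_n) (u f : 'rV[R]_n -> R).
Hypotheses (oO : open Omega) (uL : L2loc Omega u) (fL : L2loc Omega f).
Hypothesis huf : forall phi : 'rV[R]_n -> R, test_function Omega phi ->
      \int[mu]_(x in Omega) (u x * laplacian phi x) =
      \int[mu]_(x in Omega) (f x * phi x).
Variable s : seq 'I_n.

Lemma integrable_L2loc_mul c r (g : 'rV[R]_n -> R) : box c r `<=` Omega ->
  continuous g -> supp_in c r g ->
  mu.-integrable Omega (EFin \o (fun x => u x * g x)).
Proof.
move=> bO cg sg; have [M M0 gM] := supp_bounded cg sg.
have wi := restrict_box_integrable oO uL bO.
apply/(integrable_mkcond _ (open_measurable_rV oO)).
have := integrable_mul_bounded wi (continuous_measurable_rV cg) gM.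
apply: eq_integrable => // x _; rewrite /= /restrict_box !patchE.
have [bx|nbx] := pselect (box c r x).
  by rewrite !mem_set//; exact: bO.
by rewrite (sg x nbx) mulr0; case: ifP => _ //=; rewrite (sg x nbx) mulr0.
Qed.

(** The data to be glued: a cutoff chi and a function G which acts as the weak
derivative on all the test functions multiplied by chi. *)
Definition local_piece (chi G : 'rV[R]_n -> R) := [/\ smooth chi,
  forall x, 0 <= chi x <= 1, forall x, ~ Omega x -> chi x = 0,
  measurable_fun setT G /\ mu.-integrable setT (EFin \o (fun x => G x ^+ 2)) &
  forall phi, smooth phi ->
   [/\ mu.-integrable Omega (EFin \o
     (fun x => u x * partials s (fun x => chi x * phi x) x)),
       mu.-integrable setT (EFin \o (fun x => G x * (chi x * phi x))) &
       \int[mu]_(x in Omega) (u x * partials s (fun x => chi x * phi x) x) =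
       (-1) ^+ size s * \int[mu]_x (G x * (chi x * phi x))]].

Lemma local_piece0 : local_piece (fun=> 0) (fun=> 0).
Proof.
split.
- exact: smooth_cst.
- by move=> x; rewrite lexx ler01.
- by [].
- split; first exact: measurable_cst.
  rewrite (_ : EFin \o _ = cst 0%E); first exact: integrable0.
  by apply/funext => x /=; rewrite expr0n.
move=> phi sphi; rewrite (smooth_partialsZ s 0 sphi).
have e1 : (fun x => u x * (0 * partials s phi x)) = fun=> 0.
  by apply/funext => x; rewrite mul0r mulr0.
have e2 : (fun x => 0 * (0 * phi x)) = fun=> 0.
  by apply/funext => x; rewrite !mul0r.
rewrite e1 e2; split.
- exact: integrable0.
- exact: integrable0.
by rewrite /Rintegral !integral0 /= mulr0.
Qed.

Lemma local_piece_cutoff c r : (0 < size s <= 2)%N -> 0 < r ->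
  box c (9 * (2 * r)) `<=` Omega -> exists G, local_piece (cutoff c r) G.
Proof.
move=> s2 r0 bO.
have r20 : 0 < 2 * r by rewrite mulr_gt0.
have bO2 : box c (2 * r) `<=` Omega.
  apply: subset_trans bO => x /boxP bx; apply/boxP => i.
  by apply: (le_trans (bx i)); lra.
have [B hB] := functional_bound oO uL fL huf r20 bO.
pose l phi := (-1) ^+ size s * \int[mu]_(x in Omega) (u x * partials s phi x).
have ui g : test_in c (2 * r) g ->
    mu.-integrable Omega (EFin \o (fun x => u x * partials s g x)).
  move=> [sg cg]; apply: (integrable_L2loc_mul bO2).
    exact: smooth_continuous (smooth_partials s sg).
  exact: supp_partials.
have lD g h : test_in c (2 * r) g -> test_in c (2 * r) h ->
    l (fun x => g x + h x) = l g + l h.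
  move=> tg th; have [sg _] := tg; have [sh _] := th.
  rewrite /l (smooth_partialsD s sg sh) -mulrDr; congr (_ * _).
  under eq_Rintegral do rewrite mulrDr.
  by rewrite (RintegralD (open_measurable_rV oO) (ui _ tg) (ui _ th)).
have lZ (a : R) g : test_in c (2 * r) g -> l (fun x => a * g x) = a * l g.
  move=> tg; have [sg _] := tg.
  rewrite /l (smooth_partialsZ s a sg) mulrCA; congr (_ * _).
  under eq_Rintegral do rewrite mulrCA.
  by rewrite (RintegralZl _ (open_measurable_rV oO) (ui _ tg)).
have lB g : test_in c (2 * r) g -> `|l g| <= B + 4^-1 * \int[mu]_x (g x ^+ 2).
  move=> [sg cg]; rewrite /l normrM normrX normrN1 expr1n mul1r.
  exact: hB.
have [G [mG G2 HG]] := riesz_test_functions lD lZ lB.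
have G2i : mu.-integrable setT (EFin \o (fun x => G x ^+ 2)).
  apply/integrableP; split.
    by apply/measurable_EFinP; exact: measurable_funX.
  by under eq_integral do rewrite /= ger0_norm ?sqr_ge0//.
exists G; split.
- exact: cutoff_smooth.
- by move=> x; rewrite cutoff_ge0 cutoff_le1.
- by move=> x nO; rewrite cutoff_supp// => /bO2.
- by [].
move=> phi sphi.
have tphi : test_in c (2 * r) (fun x => cutoff c r x * phi x).
  split; first exact: smoothM (cutoff_smooth c r) sphi.
  by move=> x nb; rewrite cutoff_supp// mul0r.
split.
- exact: ui.
- have [sp cp] := tphi; have [M M0 hM] :=
  supp_bounded (smooth_continuous sp) cp.
  have i1 := smooth_integrable sp cp.
  have i12 := integrableD measurableT (integrable_abse i1)
    (integrableZl measurableT M G2i).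
  apply: le_integrable i12 => //.
    apply/measurable_EFinP; apply: measurable_funM => //.
    exact: continuous_measurable_rV (smooth_continuous sp).
  move=> x _ /=; rewrite lee_fin normrM.
  have := hM x; have := normr_ge0 (cutoff c r x * phi x).
  move: (`|cutoff c r x * phi x|) => p p0 pM.
  have h1 : 0 <= (M - p) * G x ^+ 2 by rewrite mulr_ge0 ?sqr_ge0// subr_ge0.
  have h2 : 0 <= p * (`|G x| - 1) ^+ 2 by rewrite mulr_ge0 ?sqr_ge0.
  have h3 : 0 <= p * `|G x| by rewrite mulr_ge0.
  have h4 : 0 <= p * `|G x| ^+ 2 by rewrite mulr_ge0 ?sqr_ge0.
  rewrite [leRHS]ger0_norm; last by rewrite addr_ge0// mulr_ge0 ?sqr_ge0.
  by move: h1; rewrite -[G x ^+ 2]real_normK ?num_real// => h1; lra.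
by rewrite -(HG _ tphi) /l mulrA -exprD addnn -mul2n exprM sqrrN !expr1n mul1r.
Qed.

Lemma box_near (c : 'rV[R]_n) r (x : 'rV[R]_n) (e : R) : 0 < e ->
  (forall i, `|x ord0 i - c ord0 i| + e <= r) -> \forall y \near x, box c r y.
Proof.
move=> e0 xc; apply: filterS (@nbhsx_ballx _ _ x e e0) => y [_ xy].
apply/boxP => i; have := xy ord0 i; rewrite /ball/= distrC => h.
rewrite (_ : _ - _ = (y ord0 i - x ord0 i) + (x ord0 i - c ord0 i));
  last by ring.
rewrite (le_trans (ler_normD _ _))// (le_trans _ (xc i))// addrC lerD2l.
exact: ltW.
Qed.

(** The cubes with rational centre and radius are enumerated, and those that are
too close to the complement of Omega contribute the zero piece. *)
Lemma local_pieces : (0 < size s <= 2)%N ->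
  exists chi G : nat -> 'rV[R]_n -> R,
    (forall m, local_piece (chi m) (G m)) /\
    (forall x, Omega x -> exists m, \forall y \near x, chi m y = 1).
Proof.
move=> s2.
pose C (q : 'rV[rat]_n) : 'rV[R]_n := \row_i ratr (q ord0 i).
pose good (qe : 'rV[rat]_n * rat) :=
  0 < (ratr qe.2 : R) /\ box (C qe.1) (9 * (2 * ratr qe.2)) `<=` Omega.
have /choice[p hp] : forall m : nat, exists p :
  ('rV[R]_n -> R) * ('rV[R]_n -> R),
    local_piece p.1 p.2 /\
    forall qe, unpickle m = Some qe -> good qe ->
      p.1 = cutoff (C qe.1) (ratr qe.2).
  move=> m; case E : (unpickle m : option ('rV[rat]_n * rat)) => [qe|];
    last first.
    by exists (fun=> 0, fun=> 0); split => //; exact: local_piece0.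
  have [[g1 g2]|ng] := pselect (good qe); last first.
    exists (fun=> 0, fun=> 0); split => [|_ [<-]//]; exact: local_piece0.
  have [G hG] := local_piece_cutoff s2 g1 g2.
  by exists (cutoff (C qe.1) (ratr qe.2), G); split => // _ [<-].
exists (fun m => (p m).1), (fun m => (p m).2); split; first by move=> m;
  have [] := hp m.
move=> x Ox.
have [e e0 eO] : exists2 e : R, 0 < e & ball x e `<=` Omega.
  by have /nbhs_ballP[e e0 eO] := open_nbhs_nbhs (conj oO Ox); exists e.
(* The cube of centre A and radius 18 q lies in the ball of radius 20 q < e. *)
have /rat_in_itvoo[q] : 0 < e / 20 by rewrite divr_gt0.
rewrite in_itv/= => /andP[q0 qe].
have /choice[a ha] : forall i, exists b :
  rat, x ord0 i - ratr q / 2 < ratr b < x ord0 i.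
  move=> i; have /rat_in_itvoo[b] : x ord0 i - ratr q / 2 < x ord0 i.
    by rewrite ltrBlDr ltrDl divr_gt0.
  by rewrite in_itv/= => hb; exists b.
pose A : 'rV[rat]_n := \row_i a i.
have xA i : `|x ord0 i - C A ord0 i| <= ratr q / 2.
  by have := ha i; rewrite !mxE => /andP[h1 h2]; rewrite ler_norml; apply/andP;
    split; lra.
have gA : good (A, q).
  split=> //= y /boxP yA; apply: eO; split=> // i j; rewrite (ord1 i) /ball/=.
  rewrite (_ : _ - _ = (x ord0 j - C A ord0 j) - (y ord0 j - C A ord0 j));
    last by ring.
  rewrite (le_lt_trans (ler_normB _ _))//.
  have := yA j; have := xA j; lra.
exists (pickle (A, q)).
have [_ /(_ (A, q) (pickleK _) gA) ->] := hp (pickle (A, q)).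
have : \forall y \near x, box (C A) (ratr q) y.
  apply: (@box_near _ _ _ (ratr q / 2)); first by rewrite divr_gt0.
  by move=> i; have := xA i; lra.
by apply: filterS => y yb; exact: cutoff1.
Qed.

End gluing.

Lemma Rintegral_sum d (T : measurableType d) (R : realType)
    (mu : {measure set T -> \bar R}) (D : set T) (F : nat -> T -> R) M :
  measurable D -> (forall m, mu.-integrable D (EFin \o F m)) ->
  mu.-integrable D (EFin \o (fun x => \sum_(m < M) F m x)) /\
  \int[mu]_(x in D) (\sum_(m < M) F m x) = \sum_(m < M) \int[mu]_(x in D) F m x.
Proof.
move=> mD iF; elim: M => [|M [IHi IH]].
  rewrite big_ord0 (_ : (fun x => _) = fun=> 0); last first.
    by apply/funext => x; rewrite big_ord0.
  by split; [exact: integrable0|rewrite /Rintegral integral0].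
rewrite big_ord_recr /= -IH (_ :
  (fun x => _) = fun x => \sum_(m < M) F m x + F M x).
  split; last by rewrite RintegralD.
  by have := integrableD mD IHi (iF M); apply: eq_integrable.
by apply/funext => x; rewrite big_ord_recr.
Qed.

Section glue.
Context {R : realType} {n : nat}.
Notation mu := (lebesgue_rV n).
Variables (Omega : set 'rV[R]_n) (u f : 'rV[R]_n -> R).
Hypotheses (oO : open Omega) (uL : L2loc Omega u) (fL : L2loc Omega f).
Hypothesis huf : forall phi : 'rV[R]_n -> R, test_function Omega phi ->
      \int[mu]_(x in Omega) (u x * laplacian phi x) =
      \int[mu]_(x in Omega) (f x * phi x).

(** The functions psi_m = chi_m * prod_(j < m) (1 - chi_j) have partial sums
1 - prod_(j < M) (1 - chi_j), which are 1 as soon as some chi_j with j < M is 1.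
By compactness, only finitely many psi_m matter on a given compact subset of
Omega. *)
Section pieces.
Variables (s : seq 'I_n) (chi G : nat -> 'rV[R]_n -> R).
Hypothesis pieces : forall m, local_piece Omega u s (chi m) (G m).
Hypothesis cover1 : forall x, Omega x ->
  exists m, \forall y \near x, chi m y = 1.

Let P m x := \prod_(j < m) (1 - chi j x).
Let psi m x := chi m x * P m x.
Let g_ M x := \sum_(m < M) G m x * psi m x.
Let g x := limn (g_^~ x).

Let schi m : smooth (chi m). Proof. by have [] := pieces m. Qed.
Let chi01 m x : 0 <= chi m x <= 1. Proof. by have [_ /(_ x)] := pieces m. Qed.

Let P01 m x : 0 <= P m x <= 1.
Proof.
have h j : 0 <= 1 - chi j x <= 1.
  by have /andP[h0 h1] := chi01 j x; apply/andP; split; lra.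
apply/andP; split; last by apply: prodr_ile1 => j _; exact: h.
by apply: prodr_ge0 => j _; have /andP[] := h j.
Qed.

Let sP m : smooth (P m).
Proof.
apply: smooth_prod => j; apply: smoothB; [exact: smooth_cst|exact: schi].
Qed.

Let P0 m j x : (j < m)%N -> chi j x = 1 -> P m x = 0.
Proof.
move=> jm cj; apply/eqP/prodf_eq0; exists (Ordinal jm) => //=.
by rewrite cj subrr.
Qed.

Let sum_psi M x : \sum_(m < M) psi m x = 1 - P M x.
Proof.
elim: M => [|M IH]; first by rewrite big_ord0 /P big_ord0 subrr.
by rewrite big_ord_recr /= IH /psi /P big_ord_recr/=; ring.
Qed.

Let g_stable j M x : chi j x = 1 -> (j < M)%N -> g_ M x = g_ j.+1 x.
Proof.
move=> cj; elim: M => // M IH; rewrite ltnS leq_eqVlt => /predU1P[->//|jM].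
by rewrite /g_ big_ord_recr /= -/(g_ M x) IH// /psi (P0 jM cj) !mulr0 addr0.
Qed.

Let gE j M x : chi j x = 1 -> (j < M)%N -> g x = g_ M x.
Proof.
move=> cj jM; apply: (cvg_lim (@Rhausdorff R)); apply: cvg_near_cst.
near=> k; rewrite (g_stable cj jM); apply: g_stable => //.
by near: k; exact: nbhs_infty_gt.
Unshelve. all: by end_near. Qed.

Let g_cvg x : g_ ^~ x @ \oo --> g x.
Proof.
have [/cover1[j /nbhs_singleton cj]|nO] := pselect (Omega x).
  apply: cvg_near_cst; near=> k; rewrite (gE cj (ltnSn j));
    apply: g_stable => //.
  by near: k; exact: nbhs_infty_gt.
have g0 k : g_ k x = 0.
  rewrite /g_ big1// => m _; have [_ _ /(_ _ nO) c0 _ _] := pieces m.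
  by rewrite /psi c0 mul0r mulr0.
have e : g_ ^~ x = fun=> 0 by apply/funext => k; exact: g0.
by rewrite /g e lim_cst//; exact: cvg_cst.
Unshelve. all: by end_near. Qed.

Let Gpsi_sq m x : (G m x * psi m x) ^+ 2 <= G m x ^+ 2.
Proof.
have /andP[c0 c1] := chi01 m x; have /andP[p0 p1] := P01 m x.
rewrite exprMn ler_piMr ?sqr_ge0// expr_le1// ?mulr_ge0//.
by rewrite mulr_ile1.
Qed.

Let mGpsi m : measurable_fun setT (fun x => G m x * psi m x).
Proof.
have [_ _ _ [mG _] _] := pieces m; apply: measurable_funM => //.
exact: continuous_measurable_rV (smooth_continuous (smoothM (schi m) (@sP m))).
Qed.

Let mg_ M : measurable_fun setT (g_ M).
Proof. by apply: measurable_sum => m; exact: mGpsi. Qed.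

Let g_sq M : mu.-integrable setT (EFin \o (fun x => g_ M x ^+ 2)).
Proof.
elim: M => [|M IH].
  rewrite (_ : EFin \o _ = cst 0%E); first exact: integrable0.
  by apply/funext => x /=; rewrite /g_ big_ord0 expr0n.
have [_ _ _ [_ iG] _] := pieces M.
have := integrableD measurableT (integrableZl measurableT 2 IH)
  (integrableZl measurableT 2 iG).
apply: le_integrable => //.
  by apply/measurable_EFinP; exact: measurable_funX.
move=> x _ /=; rewrite lee_fin [leLHS]ger0_norm ?sqr_ge0//.
rewrite [leRHS]ger0_norm; last by rewrite addr_ge0// mulr_ge0// sqr_ge0.
rewrite {1}/g_ big_ord_recr /= -/(g_ M x).
have := Gpsi_sq M x; move: (G M x * psi M x) (g_ M x) => a b ab.
have : 0 <= (a - b) ^+ 2 by rewrite sqr_ge0.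
lra.
Qed.

Let compact_stage K : compact K -> K `<=` Omega ->
  exists M, forall x, K x -> exists2 j, (j < M)%N & chi j x = 1.
Proof.
rewrite compact_cover => cK KO.
pose O j := interior [set x | chi j x = 1].
have cov : K `<=` cover [set: nat] O.
  by move=> x /KO /cover1[j hj]; exists j.
have [D _ KD] := cK nat setT O (fun j _ => @open_interior _ _) cov.
exists (\max_(j <- finmap.enum_fset D) j).+1 =>
  x /KD[j /= jD] /interior_subset/= cj.
by exists j => //; rewrite ltnS; apply: leq_bigmax_seq.
Qed.

Lemma glued_L2loc : L2loc Omega g.
Proof.
split.
  apply: measurable_funTS; apply: (measurable_fun_cvg mg_) => x _; exact: g_cvg.
move=> K cK KO; have [M hM] := compact_stage cK KO.
have mK : measurable K.
  rewrite -[K]setCK; apply: measurableC; apply: open_measurable_rV.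
  by apply: closed_openC; apply:
    (@compact_closed _ K (@norm_hausdorff R 'rV[R]_n)).
have /integrableP[_] := integrableS measurableT mK (@subsetT _ K) (g_sq M).
congr (_ < _)%E; apply: eq_integral => x /set_mem /hM[j jM cj].
by rewrite (gE cj jM) /= ger0_norm ?sqr_ge0// real_normK ?num_real.
Qed.

Lemma glued_weak_derivative : weak_derivative Omega s u g.
Proof.
move=> phi [sphi cphi phiO]; have [M hM] := compact_stage cphi phiO.
have phi0 x : ~ closed_support phi x -> phi x = 0.
  move=> nx; apply: contrapT => /eqP px; apply: nx; exact: subset_closure.
pose theta m x := chi m x * (P m x * phi x).
have phiE : phi = fun x => \sum_(m < M) theta m x.
  apply/funext => x; rewrite /theta; under eq_bigr do rewrite mulrA.
  rewrite -mulr_suml -/(psi _ _) sum_psi.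
  have [/hM[j jM cj]|/phi0 ->] := pselect (closed_support phi x).
    by rewrite (P0 jM cj) subr0 mul1r.
  by rewrite mulr0.
have stheta m : smooth (theta m) := smoothM (schi m) (smoothM (@sP m) sphi).
have pp m := let: And5 _ _ _ _ h := pieces m in h _ (smoothM (@sP m) sphi).
have e1 : \int[mu]_(x in Omega) (u x * partials s phi x) =
    \int[mu]_(x in Omega) (\sum_(m < M) u x * partials s (theta m) x).
  apply: eq_Rintegral => x _; rewrite -mulr_sumr; congr (_ * _).
  have h := smooth_partials_sum s (index_enum 'I_M) (fun m : 'I_M => stheta m).
  by rewrite [in LHS]phiE h.
have [_ e2] := @Rintegral_sum _ _ _ mu Omega
  (fun m x => u x * partials s (theta m) x) M
  (open_measurable_rV oO) (fun m => let: And3 h _ _ := pp m in h).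
have [_ e3] := @Rintegral_sum _ _ _ mu setT (fun m x => G m x * theta m x) M
  measurableT (fun m => let: And3 _ h _ := pp m in h).
rewrite e1 e2 (eq_bigr (fun m :
  'I_M => (-1) ^+ size s * \int[mu]_x (G m x * theta m x))).
  rewrite -mulr_sumr -e3; congr (_ * _); rewrite [RHS]Rintegral_mkcond.
  apply: eq_Rintegral => x _; rewrite patchE.
  have e4 : \sum_(m < M) G m x * theta m x = g_ M x * phi x.
    by rewrite /g_ mulr_suml; apply: eq_bigr => m _; rewrite /theta /psi !mulrA.
  rewrite e4; have [kx|/phi0 p0] := pselect (closed_support phi x).
    have [j jM cj] := hM _ kx; rewrite (gE cj jM) mem_set//; exact: phiO.
  by rewrite p0 !mulr0; case: ifP => //; rewrite p0 mulr0.
by move=> m _; have [] := pp m.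
Qed.

End pieces.

Lemma weak_derivative_exists (s : seq 'I_n) : (0 < size s <= 2)%N ->
  exists2 g, L2loc Omega g & weak_derivative Omega s u g.
Proof.
move=> s2; have [chi [G [pieces cover1]]] := local_pieces oO uL fL huf s2.
eexists; [exact: glued_L2loc pieces cover1|exact: glued_weak_derivative pieces
  cover1].
Qed.

End glue.

Theorem theorem1 (R : realType) (n : nat) (hn : (2 <= n)%N)
    (Omega : set 'rV[R]_n) (oOmega : open Omega)
    (f : 'rV[R]_n -> R) (hf : L2loc Omega f)
    (u : 'rV[R]_n -> R) (hu : L2loc Omega u)
    (huf : forall phi : 'rV[R]_n -> R, test_function Omega phi ->
      \int[lebesgue_rV n]_(x in Omega) (u x * laplacian phi x) =
      \int[lebesgue_rV n]_(x in Omega) (f x * phi x)) :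
  W2loc 2 Omega u.
Proof.
split=> // s s2; have [->|s0] := eqVneq s [::].
  exists u => // phi _.
  by rewrite expr0 mul1r.
apply: (weak_derivative_exists oOmega hu hf huf).
by rewrite s2 andbT lt0n size_eq0.
Qed.
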